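(* Let $\Sigma$ be an oriented cellular surface with face set $F$, set of non-oriented edges $E$, let $\theta^*\in(0,\pi)^E$ be a function on the non-oriented edges and let $\Phi\in(0,\infty)^F$ be a function on the faces. (Euclidean case) A Euclidean circle pattern which is combinatorially equivalent to $\Sigma$, which has interior intersection angles $\theta^*$, and which has cone (or boundary) angles $\Phi_f$ in the centers of the circles exists if and only if the following two conditions are satisfied: (i) $\displaystyle\sum_{f\in F}\Phi_f=\sum_{e\in E}2\theta^*_e$; (ii) if $F'\subset F$ is a nonempty subset with $F'\neq F$, and $E'$ is the set of all edges incident with any face in $F'$, then $$\sum_{f\in F'}\Phi_f<\sum_{e\in E'}2\theta^*_e .$$ The Euclidean circle pattern is unique up to similarity. (Hyperbolic case) A hyperbolic circle pattern (i.e. a circle pattern in a surface of constant curvature $-1$ with cone-like singularities) which is combinatorially equivalent to $\Sigma$, has interior intersection angles $\theta^*$ and has cone (or boundary) angles $\Phi_f$ in the centers of the circles exists if and only if the inequality $\sum_{f\in F'}\Phi_f<\sum_{e\in E'}2\theta^*_e$, with $E'$ the set of all edges incident with any face in $F'$, holds for all nonempty subsets $F'\subset F$, including $F'=F$. The hyperbolic circle pattern is unique up to isometry.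
   Context: Cellular surfaces. A cellular surface $\Sigma$ is a cellular decomposition (considered up to homeomorphism) of a compact connected oriented surface, possibly with boundary, coming from a finite graph embedded in the surface. If the surface is closed, the complement of the graph is a disjoint union of open discs (the faces). If the surface has boundary, the graph meets the boundary only in vertices, and the complement of the union of the graph and the boundary is a disjoint union of open discs; only the edges of the embedded graph count as edges of $\Sigma$ (there are no boundary edges), so every edge has a face on its left and a face on its right (possibly the same face). Loops and multiple edges are allowed. Faces whose boundary is not closed are called boundary faces, and vertices whose coboundary is not closed are called boundary vertices; the others are interior. $F$, $E$, $\vec E$, $V$ denote the sets of faces, non-oriented edges, oriented edges, and vertices; $-e$ is $e$ with reversed orientation. A function on $E$ is also regarded as a function on $\vec E$ with equal values on $e$ and $-e$. An edge is incident with the faces on its two sides. The oriented boundary of a face $f$ consists of the oriented edges having $f$ on their left. Circle patterns. Put $\theta_e=\pi-\theta^*_e$ (exterior intersection angle; $\theta^*_e$ is the interior intersection angle). Given positive radii $r_f$, $f\in F$, take for each edge $e\in E$, with faces $f_j,f_k$ on its two sides, a Euclidean (resp. hyperbolic) kite-shaped quadrilateral whose vertices are, in cyclic order, the center of the circle $f_j$, one endpoint of $e$, the center of the circle $f_k$, the other endpoint of $e$; its sides have lengths $r_{f_j},r_{f_k},r_{f_k},r_{f_j}$, and its angles at the two vertices corresponding to endpoints of $e$ are both $\theta_e$. Gluing these kites along corresponding sides (which have equal length) according to the combinatorics of $\Sigma$ gives a surface of constant curvature $0$ (resp. $-1$) with possible cone-like singularities at the centers of circles and at the points corresponding to vertices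 of $\Sigma$. Such a glued surface with the circles of radii $r_f$ is what is meant by a Euclidean (resp. hyperbolic) circle pattern combinatorially equivalent to $\Sigma$ with interior intersection angles $\theta^*$. For an oriented edge $e$ with $f_j$ on its left and $f_k$ on its right, let $\varphi_e\in(0,\pi)$ be half of the angle of the kite at the center of $f_j$. Explicitly, in the Euclidean case $$\varphi_e=\frac1{2i}\log\frac{r_{f_j}-r_{f_k}e^{-i\theta_e}}{r_{f_j}-r_{f_k}e^{i\theta_e}},$$ and in the hyperbolic case, with $t_f=\tanh(r_f/2)$, $$\varphi_e=\frac1{2i}\left(\log\frac{t_{f_j}-t_{f_k}e^{-i\theta_e}}{t_{f_j}-t_{f_k}e^{i\theta_e}}-\log\frac{1-t_{f_j}t_{f_k}e^{-i\theta_e}}{1-t_{f_j}t_{f_k}e^{i\theta_e}}\right).$$ The cone angle at the center of an interior face $f$ (for a boundary face: the interior angle of the boundary polygon of the kite decomposition at that center) is $2\sum\varphi_e$, the sum over all oriented edges in the oriented boundary of $f$. Thus the pattern has cone (or boundary) angles $\Phi_f$ if and only if $\Phi_f=2\sum\varphi_e$ for all $f\in F$. *)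

(* Defs.v *)
From HB Require Import structures.
From Stdlib Require Import Relation_Operators.
From mathcomp Require Import all_boot all_order all_algebra.
From mathcomp Require Import complex.
From mathcomp Require Import all_classical all_reals all_analysis.

Set Implicit Arguments.
Unset Strict Implicit.
Unset Printing Implicit Defensive.

Import Order.TTheory GRing.Theory Num.Theory.

Local Open Scope classical_set_scope.
Local Open Scope ring_scope.
Local Open Scope complex_scope.

(* A compact connected oriented surface, possibly with boundary, cellularly
   decomposed by a finite graph, presented as a gluing of oriented polygons.
   The sides of the polygons are the oriented edges of the graph together with
   the arcs into which the vertices divide the boundary of the surface; a side
   belongs to the face on its left, and [next] goes around each face.  The
   polygons are glued along e and [opp e] = -e; boundary arcs are not glued to
   anything and are not edges.  Vertices are the classes of corners under the
   gluing.  Faces are separate data only so as to allow a face with no side: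
   by connectedness it is then the only face (e.g. the sphere with one vertex
   and no edge). *)
Record cellular_surface := CellularSurface {
  face : finType;
  edge : finType;
  oedge : finType;
  barc : finType;
  opp : oedge -> oedge;
  oppK : involutive opp;
  opp_neq : forall e, opp e != e;
  edge_of : oedge -> edge;
  edge_of_surj : forall x, exists e, edge_of e = x;
  edge_ofP : forall e e', edge_of e = edge_of e' <-> e' = e \/ e' = opp e;
  next : oedge + barc -> oedge + barc;
  next_inj : injective next;
  side_face : oedge + barc -> face;
  side_faceP : forall s s', side_face s = side_face s' <-> fconnect next s s';
  face_nonempty : (0 < #|face|)%N;
  face_connected : forall f f', connect
    (fun g g' => [exists e : oedge,
       (side_face (inl e) == g) && (side_face (inl (opp e)) == g')]) f f'
}.

Definition left_face (S : cellular_surface) (e : oedge S) : face S :=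
  side_face (inl e : oedge S + barc S).

Definition right_face (S : cellular_surface) (e : oedge S) : face S :=
  left_face (opp e).

Definition incident (S : cellular_surface) (x : edge S) (f : face S) : bool :=
  [exists e : oedge S, (edge_of e == x) && (left_face e == f)].

Definition incident_edges (S : cellular_surface) (F' : {set face S}) :
  {set edge S} := [set x | [exists f in F', incident x f]]%SET.

Variant geometry := Euclidean | Hyperbolic.

Section Plane.
Context {R : realType}.
Implicit Types (g : geometry) (a b c x : R[i]).

(* The hyperbolic plane of curvature -1 is the Poincare disc. *)
Definition plane g : set R[i] :=
  match g with
  | Euclidean => setT
  | Hyperbolic => [set x | Normc.normc x < 1]
  end.

(* The position of x after moving c to the origin by an orientation-preserving
   isometry of the plane whose derivative at c is a positive multiple of the
   identity.  Angles at c are therefore Euclidean angles at the origin. *)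
Definition seen_from g c x : R[i] :=
  match g with
  | Euclidean => x - c
  | Hyperbolic => (x - c) / (1 - conjc c * x)
  end.

(* In the disc, |seen_from c x| = tanh (dist c x / 2). *)
Definition dist g c x : R :=
  let t := Normc.normc (seen_from g c x) in
  match g with
  | Euclidean => t
  | Hyperbolic => ln ((1 + t) / (1 - t))
  end.

(* The unoriented angle in [0, pi] at c between the directions to a and b. *)
Definition angle g c a b : R :=
  let u := seen_from g c a in
  let v := seen_from g c b in
  acos (complex.Re (u * conjc v) / (Normc.normc u * Normc.normc v)).

(* x lies strictly to the left of the geodesic ray from c through a. *)
Definition on_left g c a x : Prop :=
  0 < complex.Im (conjc (seen_from g c a) * seen_from g c x).

Definition segment g a b : set R[i] :=
  [set x | plane g x /\ dist g a x + dist g x b = dist g a b].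

Definition triangle g a b c : set R[i] :=
  [set x | exists2 y, segment g b c y & segment g a y x].

(* The kite of an oriented edge e: the centers of the circles on the left and
   on the right of e, and the points corresponding to the source and the
   target of e. *)
Record kite := Kite {
  lcenter : R[i];
  rcenter : R[i];
  source : R[i];
  target : R[i]
}.

Definition kite_opp (k : kite) : kite :=
  Kite (rcenter k) (lcenter k) (target k) (source k).

(* Cyclic order (counterclockwise): lcenter, source, rcenter, target.  The
   diagonal from lcenter to rcenter is the symmetry axis; the kite may be
   nonconvex, with a reflex angle at one of the centers. *)
Definition is_kite g (rl rr theta : R) (k : kite) : Prop :=
  [/\ [/\ plane g (lcenter k), plane g (rcenter k),
          plane g (source k) & plane g (target k)],
      dist g (lcenter k) (source k) = rl /\ dist g (lcenter k) (target k) = rl,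
      dist g (rcenter k) (source k) = rr /\ dist g (rcenter k) (target k) = rr,
      angle g (source k) (lcenter k) (rcenter k) = theta /\
      angle g (target k) (lcenter k) (rcenter k) = theta
    & on_left g (lcenter k) (rcenter k) (target k) /\
      on_left g (lcenter k) (source k) (rcenter k)].

Definition kite_region g (k : kite) : set R[i] :=
  triangle g (lcenter k) (rcenter k) (target k) `|`
  triangle g (lcenter k) (rcenter k) (source k).

End Plane.

Arguments kite R : clear implicits.

(* [thetas] is the interior intersection angle theta^*; the kite of an edge has
   the exterior angle pi - theta^* at the endpoints of the edge.  The
   unoriented edge e carries a single kite, described from both sides. *)
Record circle_pattern (R : realType) (g : geometry) (S : cellular_surface)
    (thetas : edge S -> R) := CirclePattern {
  radius : face S -> R;
  radius_gt0 : forall f, 0 < radius f;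
  pkite : oedge S -> kite R;
  pkite_opp : forall e, pkite (opp e) = kite_opp (pkite e);
  pkiteP : forall e, is_kite g (radius (left_face e)) (radius (right_face e))
                       (pi - thetas (edge_of e)) (pkite e)
}.

Section Pattern.
Context {R : realType} {g : geometry} {S : cellular_surface}.
Context {thetas : edge S -> R}.
Implicit Types (P Q : circle_pattern g thetas) (p q : oedge S * R[i]).

(* Half of the angle of the kite at the center on the left of e: the angle
   between a side and the symmetry axis (so that the kite angle itself may
   exceed pi). *)
Definition half_angle P (e : oedge S) : R :=
  let k := pkite P e in angle g (lcenter k) (target k) (rcenter k).

(* For a boundary face: the interior angle of the boundary polygon. *)
Definition cone_angle P (f : face S) : R :=
  2 * \sum_(e : oedge S | left_face e == f) half_angle P e.

Definition has_cone_angles P (Phi : face S -> R) : Prop :=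
  forall f, cone_angle P f = Phi f.

(* The glued surface is the set of pairs (e, x), x in the kite of e, modulo the
   equivalence relation [same_point]. *)
Definition on_surface P p : Prop := kite_region g (pkite P p.1) p.2.

(* The kites of e and -e are the same, and the side of the kite of e from the
   left center to the target is glued to the side of the kite of the next edge
   around that face from the left center to the source. *)
Definition glue P p q : Prop :=
  [\/ [/\ on_surface P p, q.1 = opp p.1 & q.2 = p.2]
    | let k := pkite P p.1 in
      let k' := pkite P q.1 in
      [/\ next (inl p.1 : oedge S + barc S) = inl q.1,
          segment g (lcenter k) (target k) p.2,
          segment g (lcenter k') (source k') q.2
        & dist g (lcenter k) p.2 = dist g (lcenter k') q.2]].

Definition same_point P : oedge S * R[i] -> oedge S * R[i] -> Prop :=
  clos_refl_sym_trans _ (glue P).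

(* h induces a bijection between the glued surfaces which maps kites to
   corresponding kites, multiplying lengths by lambda, and hence circles to
   corresponding circles. *)
Definition is_similarity (lambda : R) P Q (h : oedge S -> R[i] -> R[i]) : Prop :=
  [/\ forall e, set_bij (kite_region g (pkite P e))
                        (kite_region g (pkite Q e)) (h e),
      forall e x y, kite_region g (pkite P e) x -> kite_region g (pkite P e) y ->
        dist g (h e x) (h e y) = lambda * dist g x y,
      forall e, let k := pkite P e in
        pkite Q e = Kite (h e (lcenter k)) (h e (rcenter k))
                         (h e (source k)) (h e (target k))
    & forall p q, on_surface P p -> on_surface P q ->
        same_point P p q <-> same_point Q (p.1, h p.1 p.2) (q.1, h q.1 q.2)].

Definition similar_patterns P Q : Prop :=
  exists2 lambda : R, 0 < lambda & exists h, is_similarity lambda P Q h.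

Definition isometric_patterns P Q : Prop := exists h, is_similarity 1 P Q h.

End Pattern.

(* Main.v *)
Require Import Defs.
From mathcomp Require Import all_boot all_order all_algebra.
From mathcomp Require Import complex ring lra.
From mathcomp Require Import all_classical all_reals all_analysis.
Import Defs.
Import Order.TTheory GRing.Theory Num.Theory.
Import numFieldNormedType.Exports.
Set Implicit Arguments.
Unset Strict Implicit.
Unset Printing Implicit Defensive.
Local Open Scope ring_scope.

(** Let rho_f be the logarithm of r_f in the Euclidean case and of tanh(r_f / 2)
in the hyperbolic case.  A circle pattern amounts to the choice of these
numbers: the law of cosines determines the kites up to congruence, and any
positive radii are possible.  In these coordinates the half angle of a kite with
exterior angle theta, at the left center, is
  T(rho_r - rho_l)                        in the Euclidean case,
  T(rho_r - rho_l) - T(rho_r + rho_l)     in the hyperbolic case,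
where T, [tri_angle], increases from 0 to pi - theta = theta^* and satisfies
T(x) + T(-x) = theta^*.  Everything else uses only properties of this function:
the two half angles of an edge add up to theta^* (resp. to less than theta^* ),
each is less than theta^*, decreases with the radius of its own circle and
increases with the radius of the other one.

Necessity. The angle sum over F' splits into contributions of the edges
incident with F'. An edge with both sides in F' contributes the sum of its two
half angles, any other edge a single half angle, which is strictly less than
theta^*. In the Euclidean case connectedness provides an edge of the second
kind if F' is a proper subset ([sum_total_angle_lt], [sum_total_angle_euc]).

Existence. The monotonicity makes the equations a discrete analogue of an
elliptic boundary value problem, which Perron's method solves. Fix a ceiling c
and consider all rho <= c such that each face either touches the ceiling or
has at most the prescribed angle. If these rho have a common lower bound,
their pointwise infimum is again one of them, and no face of it has less than
the prescribed angle, because its radius could be decreased ([perron]). The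
combinatorial condition gives the lower bound: if some rho_f is very negative,
the values of rho have a wide gap, and at the faces F' below the gap, which do
not touch the ceiling, the angles sum up to almost the sum of 2 theta^* over
the edges incident with F', hence to more than prescribed ([barrier_bounded]).
In the hyperbolic case a ceiling close to 0 makes the angles at the faces that
touch it smaller than prescribed, so the infimum is a solution. In the
Euclidean case the total angle is always the prescribed one, so that an
inequality in the same direction at all faces is an equality at all faces;
this applies to the infimum, or, if some competitor does not touch the
ceiling, to that competitor.

Uniqueness. If rho and rho' are solutions, then comparing the angles at a face
where rho' - rho is maximal shows that the maximum is at most 0 in the
hyperbolic case, and that it is taken by all neighbours, hence everywhere, in
the Euclidean case ([hyperbolic_radii_le], [euclidean_radii_unique]). Equal
radii, or radii with constant ratio, give congruent, or similar, kites, and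
the maps between the kites respect the gluing ([kite_similar],
[similarity_exists]). *)

(** * The half angle of a kite as a function of the radii *)

Section TriangleAngle.
Context {R : realType}.
Implicit Types (a x y theta t : R).

Definition acot (y : R) : R := pi / 2 - atan y.

Lemma acot_gt0 y : 0 < acot y.
Proof. by rewrite subr_gt0 atan_ltpi2. Qed.

Lemma acot_ltpi y : acot y < pi.
Proof. have := atan_gtNpi2 y; rewrite /acot; lra. Qed.

Lemma acot_decr : {mono acot : x y /~ x < y}.
Proof.
move=> x y; rewrite /acot ltrD2l ltrN2.
apply/idP/idP; last exact: lt_atan.
by apply: contraTT; rewrite -!leNgt; apply: le_atan.
Qed.

Lemma acot_le x y : x <= y -> acot y <= acot x.
Proof. by move=> xy; rewrite lerD2l lerN2 le_atan. Qed.

Lemma acot_continuous : continuous acot.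
Proof.
move=> x; apply: cvgB; first exact: cvg_cst.
exact: continuous_atan.
Qed.

(** Angles in the open interval from 0 to pi are recognized by their cotangent;
all explicit angles below are identified in this way. *)
Lemma acot_eq a y s : 0 < a < pi -> 0 < s -> sin a * y = cos a * s ->
  acot (y / s) = a.
Proof.
move=> /andP[a0 api] s0 e.
have sa : 0 < sin a by rewrite sin_gt0_pi ?a0.
have -> : y / s = tan (pi / 2 - a).
  rewrite /tan sinB cosB sin_pihalf cos_pihalf !mul1r !mul0r subr0 add0r.
  by apply/eqP; rewrite (eqr_div _ _ (lt0r_neq0 s0) (lt0r_neq0 sa)) mulrC e.
by rewrite /acot tanK ?in_itv/= ; [ring|lra].
Qed.

Lemma acotP y : [/\ 0 < sin (acot y) & cos (acot y) = y * sin (acot y)].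
Proof.
have s0 : 0 < sin (acot y) by rewrite sin_gt0_pi// acot_gt0 acot_ltpi.
split=> //.
rewrite /acot cosB sinB sin_pihalf cos_pihalf !mul1r !mul0r subr0 add0r.
have c0 : 0 < cos (atan y) by rewrite cos_gt0_pihalf// atan_ltpi2 atan_gtNpi2.
by rewrite -{2}[y]atanK /tan divfK ?(lt0r_neq0 c0).
Qed.

Lemma acos_polar a (X Y : R) : 0 < a < pi -> 0 < Y -> sin a * X = cos a * Y ->
  acos (X / Num.sqrt (X ^+ 2 + Y ^+ 2)) = a.
Proof.
move=> /andP[a0 api] Y0 e.
have sa : 0 < sin a by rewrite sin_gt0_pi ?a0.
have m0 : 0 < Y / sin a by rewrite divr_gt0.
have EX : X = Y / sin a * cos a.
  by rewrite mulrAC [Y * _]mulrC -e mulrAC mulfV ?mul1r ?(lt0r_neq0 sa).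
have EY : Y = Y / sin a * sin a by rewrite divfK ?(lt0r_neq0 sa).
have -> : X ^+ 2 + Y ^+ 2 = (Y / sin a) ^+ 2.
  rewrite {1}EX {2}EY !exprMn -mulrDr cos2Dsin2 mulr1; done.
rewrite sqrtr_sqr gtr0_norm// EX [Y / _ * _]mulrC mulfK ?(lt0r_neq0 m0)//.
by rewrite cosK// in_itv/= !ltW.
Qed.

(** The angle opposite to the side b in a Euclidean triangle with sides a and b
that enclose the angle theta, for b / a = exp x. *)
Definition tri_angle theta x := acot ((expR (- x) - cos theta) / sin theta).

Section Fixed.
Variable theta : R.
Hypothesis th : 0 < theta < pi.
Let f := tri_angle theta.
Let s0 : 0 < sin theta. Proof. exact: sin_gt0_pi. Qed.

(** The law of sines: the third angle of the triangle is pi - theta - a. *)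
Lemma tri_angle_eq a x : 0 < a < pi -> expR (- x) * sin a = sin (a + theta) ->
  tri_angle theta x = a.
Proof.
move=> a0 e; apply: acot_eq => //.
by rewrite mulrBr [sin a * expR _]mulrC e sinD; ring.
Qed.

Lemma tri_angleP x : expR (- x) * sin (f x) = sin (f x + theta).
Proof.
have [sf cf] := acotP ((expR (- x) - cos theta) / sin theta).
rewrite sinD -/f [cos (f x)]cf -/(f x).
by field; rewrite gt_eqF.
Qed.

Lemma tri_angle_gt0 x : 0 < f x. Proof. exact: acot_gt0. Qed.

(** The bound is the angle whose cotangent is the limit of the defining one. *)
Lemma tri_angle_lt x : f x < pi - theta.
Proof.
have <- : acot ((- cos theta) / sin theta) = pi - theta.
  apply: acot_eq => //; first by move: th; lra.
  by rewrite addrC cosDpi sinDpi sinN cosN; ring.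
by rewrite acot_decr ltr_pM2r ?invr_gt0// ltrDr expR_gt0.
Qed.

Lemma tri_angle_incr : {mono f : x y / x < y}.
Proof.
move=> x y; rewrite /f/tri_angle acot_decr ltr_pM2r ?invr_gt0// ltrD2r.
by rewrite ltr_expR ltrN2.
Qed.

Lemma tri_angle_le x y : x <= y -> f x <= f y.
Proof.
by rewrite le_eqVlt => /orP[/eqP->//|]; rewrite -tri_angle_incr => /ltW.
Qed.

Lemma tri_angle_continuous : continuous f.
Proof.
move=> x.
apply: (@continuous_comp _ _ _
  (fun x => (expR (- x) - cos theta) / sin theta) acot); last first.
  exact: acot_continuous.
apply: cvgMl; apply: cvgB; last exact: cvg_cst.
apply: (@continuous_comp _ _ _ (fun x : R => - x) expR).
  exact: opp_continuous.
exact: continuous_expR.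
Qed.

(** Exchanging the two sides exchanges the two unknown angles, which together
with theta make pi. *)
Lemma tri_angleN x : f (- x) = pi - theta - f x.
Proof.
apply: tri_angle_eq.
  by move: (tri_angle_lt x) (tri_angle_gt0 x) th => ?? /andP[??]; lra.
rewrite opprK (_ : pi - theta - f x + theta = - f x + pi); last by ring.
rewrite (_ : pi - theta - f x = - (f x + theta) + pi); last by ring.
rewrite !sinDpi !sinN !opprK -tri_angleP mulrA -expRD subrr expR0 mul1r.
done.
Qed.

Lemma tri_angle_limit t : 0 < t -> exists2 M, 0 <= M &
  (forall x, M <= x -> pi - theta - t <= f x) /\
  (forall x, x <= - M -> f x <= t).
Proof.
move=> t0.
have [a [a0 at_ ath]] : exists a, [/\ 0 < a, a <= t & a < pi - theta].
  exists (Num.min t ((pi - theta) / 2)); move: th => /andP[??].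
  have p2 : 0 < (pi - theta) / 2 by lra.
  have p3 : (pi - theta) / 2 < pi - theta by lra.
  by split; rewrite ?lt_min ?ge_min ?gt_min ?lexx ?t0 ?p2 ?p3 ?orbT.
(* The law of sines gives the point where the angle is a; monotonicity does the
   rest. *)
have sa : 0 < sin a by apply: sin_gt0_pi; move: th; lra.
have sat : 0 < sin (a + theta) by apply: sin_gt0_pi; move: th; lra.
pose x0 := - ln (sin (a + theta) / sin a).
have fx0 : f x0 = a.
  apply: tri_angle_eq; first by move: th; lra.
  by rewrite opprK lnK ?posrE ?divr_gt0// divfK ?gt_eqF.
have low x : x <= - `|x0| -> f x <= t.
  move=> xx; apply: le_trans at_; rewrite -fx0; apply: tri_angle_le.
  by apply: le_trans xx _; rewrite lerNl -normrN ler_norm.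
exists `|x0| => //; split => // x xx.
have := low (- x); rewrite lerN2 tri_angleN => /(_ xx); lra.
Qed.

End Fixed.

(** The half angle at a center, x and y being the logarithmic radii (of r, or of
tanh (r / 2)) of the circle around that center and of the other circle. *)
Definition half_kite_angle (g : geometry) theta x y : R :=
  match g with
  | Euclidean => tri_angle theta (y - x)
  | Hyperbolic => tri_angle theta (y - x) - tri_angle theta (y + x)
  end.

(** Where logarithmic radii lie: tanh (r / 2) < 1 for all r. *)
Definition log_dom (g : geometry) x : Prop :=
  match g with Euclidean => True | Hyperbolic => x < 0 end.

Section Half.
Variables (g : geometry) (theta : R).
Hypothesis th : 0 < theta < pi.
Let s0 : 0 < sin theta. Proof. exact: sin_gt0_pi. Qed.
Local Notation phi := (half_kite_angle g theta).

Lemma half_kite_angle_lt x y : phi x y < pi - theta.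
Proof.
rewrite /half_kite_angle; case: g; first exact: tri_angle_lt.
have := tri_angle_lt th (y - x); have := tri_angle_gt0 theta (y + x); lra.
Qed.

Lemma half_kite_angle_decr x x' y : x < x' -> phi x' y < phi x y.
Proof.
move=> xx; rewrite /half_kite_angle; case: g; first by rewrite tri_angle_incr//; lra.
by apply: ltr_leB; rewrite ?tri_angle_le// ?tri_angle_incr//; lra.
Qed.

(** The hyperbolic cotangent formula.  The difference of two angles shows the
behaviour in x and under translations, this single cotangent the behaviour
in y. *)
Lemma half_kite_angle_hyp x y : x < 0 ->
  half_kite_angle Hyperbolic theta x y =
  acot ((expR x * (expR (- y) + expR y) - (1 + expR x ^+ 2) * cos theta) /
        (sin theta * (1 - expR x ^+ 2))).
Proof.
move=> x0; apply/esym; apply: acot_eq.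
- have := tri_angle_gt0 theta (y + x); have := tri_angle_lt th (y - x).
  have : 0 < half_kite_angle Hyperbolic theta x y.
    by rewrite subr_gt0 tri_angle_incr//; lra.
  by move: th; rewrite /half_kite_angle; lra.
- by rewrite mulr_gt0// subr_gt0 expr_lt1 ?expR_ge0// expR_lt1.
rewrite /half_kite_angle sinB cosB /tri_angle.
have [_ ->] := acotP ((expR (- (y - x)) - cos theta) / sin theta).
have [_ ->] := acotP ((expR (- (y + x)) - cos theta) / sin theta).
set S1 := sin _; set S2 := sin (acot _).
have ex0 : expR x != 0 by rewrite gt_eqF ?expR_gt0.
have ey0 : expR y != 0 by rewrite gt_eqF ?expR_gt0.
rewrite !opprD opprK !expRD !expRN.
have := cos2Dsin2 theta.
move: ex0 ey0 (lt0r_neq0 s0).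
move: (expR x) (expR y) (sin theta) (cos theta) S1 S2 => X Y s c S1 S2 X0 Y0 sn E.
(* The two sides differ by a multiple of cos^2 + sin^2 - 1. *)
apply/eqP; rewrite -subr_eq0; apply/eqP.
transitivity (S1 * S2 * (1 - X ^+ 2) / s * (1 - (c ^+ 2 + s ^+ 2))).
  by field; rewrite X0 Y0 sn.
by rewrite E subrr mulr0.
Qed.

(** In the hyperbolic case the cotangent depends on y through cosh y, which
decreases on the negative half-line. *)
Lemma half_kite_angle_le x y y' : log_dom g x -> log_dom g y' -> y <= y' ->
  phi x y <= phi x y'.
Proof.
case: g => x0 y0 yy; first by rewrite /= tri_angle_le//; lra.
have {}x0 : x < 0 := x0; have {}y0 : y' < 0 := y0.
have Dx : 0 < 1 - expR x ^+ 2 by rewrite subr_gt0 expr_lt1 ?expR_ge0// expR_lt1.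
rewrite !(half_kite_angle_hyp _ x0); apply: acot_le.
rewrite ler_pM2r ?invr_gt0 ?mulr_gt0// lerD2r ler_pM2l ?expR_gt0// !expRN.
have Y1 : expR y' < 1 by rewrite expR_lt1.
have Y0 := expR_gt0 y.
have YY : expR y <= expR y' by rewrite ler_expR.
move: (expR y) (expR y') Y0 Y1 YY => u v u0 v1 uv.
have v0 : 0 < v by apply: lt_le_trans uv.
rewrite -subr_ge0.
have -> : u^-1 + u - (v^-1 + v) = (v - u) * (1 - u * v) / (u * v).
  by field; rewrite !lt0r_neq0.
have uv1 : u * v < 1.
  by apply: mulr_ilt1; rewrite ?(ltW u0) ?(ltW v0)//; apply: le_lt_trans uv v1.
by rewrite divr_ge0 ?mulr_ge0// ?subr_ge0 ?(ltW uv1) ?(ltW u0) ?(ltW v0).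
Qed.

Lemma half_kite_angle_add x y :
  phi x y + phi y x = pi - theta -
    match g with Euclidean => 0 | Hyperbolic => 2 * tri_angle theta (x + y) end.
Proof.
rewrite /half_kite_angle; have := tri_angleN th (x - y); rewrite opprB => E.
by case: g; rewrite E ?[y + x]addrC; ring.
Qed.

Lemma half_kite_angle_continuous (u : R -> R) : continuous u ->
  continuous (fun t => phi t (u t)).
Proof.
move=> cu t; rewrite /half_kite_angle.
have c1 : {for t, continuous (fun t => tri_angle theta (u t - t))}.
  apply: (@continuous_comp _ _ _ (fun t => u t - t) (tri_angle theta)).
    by apply: cvgB; [exact: cu|exact: cvg_id].
  exact: tri_angle_continuous.
have c2 : {for t, continuous (fun t => tri_angle theta (u t + t))}.
  apply: (@continuous_comp _ _ _ (fun t => u t + t) (tri_angle theta)).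
    by apply: cvgD; [exact: cu|exact: cvg_id].
  exact: tri_angle_continuous.
by case: g => //; apply: cvgB; [exact: c1|exact: c2].
Qed.

(** If a circle is small, and much smaller than the one across the edge, its
half angle is almost theta^*; if both are very small, the kite is almost
Euclidean and the two half angles add up to almost theta^*. *)
Lemma half_kite_angle_limit t : 0 < t -> exists2 M, 0 <= M &
  forall x y, log_dom g x -> log_dom g y -> x <= - M ->
    [/\ M <= y - x -> pi - theta - t <= phi x y
      & y <= - M -> pi - theta - t <= phi x y + phi y x].
Proof.
move=> t0; have t2 : 0 < t / 2 by lra.
have [M M0 [hi lo]] := tri_angle_limit th t2; exists M => // x y dx dy xM.
split.
  move=> /hi yx; rewrite /half_kite_angle; move: dx dy; case: g => /= x0 y0; first lra.
  by have := lo (y + x); rewrite (_ : y + x <= - M); [move=> /(_ isT); lra|lra].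
move=> yM; rewrite half_kite_angle_add; case: g dx dy => /= x0 y0; first lra.
have := lo (x + y); rewrite (_ : x + y <= - M); last lra.
by move=> /(_ isT); lra.
Qed.

End Half.

(** The comparison behind hyperbolic uniqueness. Enlarging both circles by the
same factor decreases the angle, but y translated by x' - x might leave the
range of y, which is why y' < y, where monotonicity in each variable suffices,
is treated separately. *)
Lemma half_kite_angle_shift theta x y x' y' : 0 < theta < pi ->
    y < 0 -> x' < 0 -> x < x' -> y' - y <= x' - x ->
  half_kite_angle Hyperbolic theta x' y' < half_kite_angle Hyperbolic theta x y.
Proof.
move=> th y0 x0 xx yx; have [yy|yy] := ltP y' y.
  apply: le_lt_trans (half_kite_angle_decr Hyperbolic th y xx).
  by apply: half_kite_angle_le => //; exact: ltW.
rewrite /half_kite_angle.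
by apply: ler_ltB; rewrite ?tri_angle_le// ?tri_angle_incr//; lra.
Qed.

End TriangleAngle.

(** * Perron's method on a finite set *)

Section Perron.
Context {R : realType} {F : finType}.
Implicit Types (rho : F -> R) (f g : F).

Definition upd rho f t g := if g == f then t else rho g.

Lemma updE rho f t : upd rho f t f = t. Proof. by rewrite /upd eqxx. Qed.

Lemma upd_id rho f : upd rho f (rho f) = rho.
Proof. by apply/funext => g; rewrite /upd; case: eqP => [->|]. Qed.

(** The competitors of Perron's method for the equation A rho = Phi: the
ceiling c is an obstacle, and off it they are supersolutions, for operators A
that decrease in the value at the point itself. *)
Definition barrier (A : (F -> R) -> F -> R) (Phi : F -> R) (c : R) rho :=
  forall f, rho f <= c /\ (rho f = c \/ A rho f <= Phi f).

(** The infimum m of all competitors is a competitor: where A m exceeded Phi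
below the ceiling, a competitor close enough to m would also exceed it, since
it lies above m elsewhere. And A m >= Phi: otherwise decreasing m slightly at
one point would give a smaller competitor. *)
Lemma perron (A : (F -> R) -> F -> R) (Phi : F -> R) (b c : R) :
  (forall rho rho' f, (forall g, rho g <= rho' g) -> (forall g, rho' g <= c) ->
     rho f = rho' f -> A rho f <= A rho' f) ->
  (forall rho f, continuous (fun t => A (upd rho f t) f)) ->
  (forall rho, barrier A Phi c rho -> forall f, b <= rho f) ->
  exists2 rho, barrier A Phi c rho & forall f, Phi f <= A rho f.
Proof.
move=> mono cont bound.
pose L f := [set x | exists2 rho, barrier A Phi c rho & rho f = x]%classic.
have top : barrier A Phi c (fun=> c) by move=> f; split => //; left.
have hasL f : has_inf (L f).
  split; first by exists c; exists (fun=> c).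
  by exists b => _ [rho Hrho <-]; exact: bound.
pose m f := inf (L f).
have m_le rho f : barrier A Phi c rho -> m f <= rho f.
  by move=> Hrho; apply: ge_inf; [case: (hasL f)|exists rho].
have mc f : m f <= c by exact: (m_le _ f top).
have m_close f t : m f < t -> exists2 rho, barrier A Phi c rho & rho f < t.
  by move=> /(inf_lt (proj1 (hasL f))) [_ [rho Hrho <-]]; exists rho.
have Hm : barrier A Phi c m.
  move=> f; split => //; have := mc f; rewrite le_eqVlt => /orP[/eqP->|mfc].
    by left.
  right; rewrite leNgt; apply/negP => lt.
  have : (\forall t \near m f, Phi f < A (upd m f t) f)%classic.
    by have /cvgr_gt := cont m f (m f); apply; rewrite upd_id.
  move=> /nbhs_ballP [d /= d0 Hd].
  have [|rho Hrho] := m_close f (Num.min c (m f + d)).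
    by rewrite lt_min mfc ltrDl.
  rewrite lt_min => /andP[rc rd].
  have mr := m_le _ f Hrho.
  have : Phi f < A (upd m f (rho f)) f.
    by apply: Hd; rewrite /ball /= distrC ger0_norm ?subr_ge0// ltrBlDl.
  rewrite ltNge => /negP; apply.
  case: (Hrho f) => _ [e|]; first by rewrite e ltxx in rc.
  apply: le_trans; apply: mono; last by rewrite updE.
  - by move=> h; rewrite /upd; case: eqP => [->//|_]; exact: m_le.
  - by move=> h; case: (Hrho h).
exists m => // f; rewrite leNgt; apply/negP => lt.
have : (\forall t \near m f, A (upd m f t) f < Phi f)%classic.
  by have /cvgr_lt := cont m f (m f); apply; rewrite upd_id.
move=> /nbhs_ballP [d /= d0 Hd].
have d2 : 0 < d / 2 by rewrite divr_gt0.
have lower g : upd m f (m f - d / 2) g <= m g.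
  by rewrite /upd; case: eqP => [->|//]; rewrite gerBl ltW.
have : barrier A Phi c (upd m f (m f - d / 2)).
  move=> g; split; first exact: le_trans (lower g) (mc g).
  case: (g =P f) => [->|/eqP gf].
    right; apply/ltW/Hd; rewrite /ball/= opprB addrC subrK gtr0_norm//.
    by rewrite ltr_pdivrMr// ltr_pMr// ltr1n.
  have ug : upd m f (m f - d / 2) g = m g by rewrite /upd (negbTE gf).
  rewrite ug; case: (Hm g) => _ [->|H]; [by left|right].
  by apply: le_trans H; apply: mono.
by move=> /(m_le _ f); rewrite updE leNgt gtrBl d2.
Qed.

(** Pigeonhole: the sets of points more than M * i below the ceiling decrease
with i, so that two consecutive ones coincide before they become empty. *)
Lemma level_gap rho (c M : R) f0 : 0 <= M ->
    rho f0 < c - M * (#|F|.+1)%:R ->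
  exists F' : {set F}, [/\ F' != finset.set0,
    forall f, f \in F' -> rho f < c - M &
    forall f g, f \in F' -> g \notin F' -> M <= rho g - rho f].
Proof.
move=> M0 low.
pose L i := [set f | rho f < c - M * i%:R]%SET.
have mem i : (i <= #|F|.+1)%N -> f0 \in L i.
  move=> i_le; rewrite inE; apply: lt_le_trans low _.
  by rewrite lerD2l lerN2 ler_wpM2l// ler_nat.
have sub i : L i.+1 \subset L i.
  apply/fintype.subsetP => f; rewrite !inE => /lt_le_trans; apply.
  by rewrite lerD2l lerN2 ler_wpM2l// ler_nat.
(* Otherwise each of the first #|F| + 1 steps loses a point of F. *)
have [i i_le Li] : exists2 i, (i <= #|F|)%N & L i = L i.+1.
  apply: contrapT => no.
  have card i : (i <= #|F|.+1)%N -> (#|L i| + i <= #|F|)%N.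
    elim: i => [_|i IH i_le]; first by rewrite addn0 max_card.
    have {}IH := IH (ltnW i_le); apply: leq_trans IH; rewrite addnS -addSn leq_add2r.
    apply: proper_card; rewrite finset.properEneq sub andbT.
    by apply/eqP => e; apply: no; exists i.
  have := card _ (leqnn _); rewrite addnS ltnNge => /negP; apply.
  exact: leq_addl.
exists (L i); split.
- by apply/set0Pn; exists f0; rewrite mem// ltnW.
- move=> f; rewrite Li inE => /lt_le_trans; apply.
  by rewrite lerD2l lerN2 -[leLHS]mulr1 ler_wpM2l// ler1n.
move=> f g; rewrite {1}Li !inE -leNgt => fl gl.
have : M * i.+1%:R = M * i%:R + M by rewrite -addn1 natrD mulrDr mulr1.
by lra.
Qed.

(** For finitely many statements that hold from some bound on, the sum of the
bounds is a common one. *)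
Lemma common_bound (T : finType) (P : T -> R -> Prop) :
  (forall t, exists2 M, 0 <= M & forall x, M <= x -> P t x) ->
  exists2 M, 0 <= M & forall t x, M <= x -> P t x.
Proof.
move=> H; pose m t := projT1 (cid2 (H t)).
have mP t : 0 <= m t /\ forall x, m t <= x -> P t x.
  by rewrite /m; case: cid2.
exists (\sum_t m t); first by apply: sumr_ge0 => t _; case: (mP t).
move=> t x tx; apply: (mP t).2; apply: le_trans tx.
by rewrite (bigD1 t)//= lerDl; apply: sumr_ge0 => u _; case: (mP u).
Qed.

End Perron.

(** * Angle sums and the system of equations for the radii *)

Section Surface.
Context {S : cellular_surface}.
Implicit Types (e : oedge S) (x : edge S) (f : face S).

Lemma edge_of_opp e : edge_of (opp e) = edge_of e.
Proof. by apply/edge_ofP; right; rewrite oppK. Qed.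

Lemma right_opp e : right_face (opp e) = left_face e.
Proof. by rewrite /right_face oppK. Qed.

(** This is what the connectedness of the surface is used for. *)
Lemma crossing_edge (F' : {set face S}) :
    F' != finset.set0 -> F' != [set: face S]%SET ->
  exists2 e, left_face e \in F' & right_face e \notin F'.
Proof.
move=> /set0Pn[f0 f0F'] FT; apply: contrapT => no.
case/negP: FT; apply/eqP/finset.setP => f; rewrite !inE.
have /connectP[p] := face_connected f0 f.
elim: p f0 f0F' => [|g p IH] f0 f0F' /= => [_ -> //|/andP[]].
move=> /existsP[e /andP[/eqP le /eqP re]] pth lst; apply: IH pth lst.
apply/negPn/negP => gF; apply: no; exists e; first by rewrite /left_face le.
by rewrite /right_face /left_face re.
Qed.

Lemma in_incident_edges (F' : {set face S}) e :
  left_face e \in F' -> edge_of e \in incident_edges F'.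
Proof.
move=> eF; rewrite inE; apply/existsP; exists (left_face e); rewrite eF /=.
by apply/existsP; exists e; rewrite !eqxx.
Qed.

Lemma incident_edgesP (F' : {set face S}) x : x \in incident_edges F' ->
  exists2 e, edge_of e = x & left_face e \in F'.
Proof.
rewrite inE => /existsP[f /andP[fF' /existsP[e /andP[/eqP <- /eqP le]]]].
by exists e; rewrite ?le.
Qed.

Section Sum.
Context {R : realType}.
Variables (F' : {set face S}) (a : oedge S -> R).

(** The contribution of an unoriented edge to an angle sum over F': the values
of a on one or both of its orientations. *)
Definition edge_share x :=
  \sum_(e | (edge_of e == x) && (left_face e \in F')) a e.

Lemma sum_over_faces : \sum_(f in F') \sum_(e | left_face e == f) a e =
  \sum_(x in incident_edges F') edge_share x.
Proof.
transitivity (\sum_(e | left_face e \in F') a e).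
  rewrite [RHS](partition_big (@left_face S) (mem F'))//=.
  apply: eq_bigr => f fF; apply: eq_bigl => e.
  by case: eqP => [->|]; rewrite ?fF ?andbF.
rewrite (partition_big (@edge_of S) (mem (incident_edges F')))/=; last first.
  by move=> e; exact: in_incident_edges.
by apply: eq_bigr => x _; apply: eq_bigl => e; rewrite andbC.
Qed.

Lemma edge_shareP x : x \in incident_edges F' ->
  exists2 e, edge_of e = x /\ left_face e \in F' &
  edge_share x = a e + (if right_face e \in F' then a (opp e) else 0).
Proof.
move=> /incident_edgesP[e <- eF]; exists e => //.
rewrite /edge_share (bigD1 e) ?eqxx//=; congr (_ + _).
rewrite (eq_bigl (fun e' => (e' == opp e) && (right_face e \in F'))); last first.
  move=> e'; case: (e' =P opp e) => [->|ne].
    by rewrite edge_of_opp eqxx opp_neq andbT.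
  apply/negbTE/negP => /andP[/andP[/eqP ee _] /eqP ne'].
  by have /edge_ofP[] := esym ee.
case: ifP => rF; last by rewrite big1// => e'; rewrite andbF.
by rewrite (eq_bigl (pred1 (opp e))) ?big_pred1_eq// => e'; rewrite andbT.
Qed.

End Sum.
End Surface.

Section Solve.
Context {R : realType} {S : cellular_surface}.
Variables (thetas : edge S -> R) (Phi : face S -> R).
Hypothesis thetas_itv : forall x : edge S, 0 < thetas x < pi.
Implicit Types (e : oedge S) (x : edge S) (f : face S).
Implicit Types (rho : face S -> R) (g : geometry).

Local Notation ext e := (pi - thetas (edge_of e)).

Definition edge_angle g rho e :=
  half_kite_angle g (ext e) (rho (left_face e)) (rho (right_face e)).

Definition total_angle g rho f :=
  2 * \sum_(e | left_face e == f) edge_angle g rho e.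

Lemma ext_itv e : 0 < ext e < pi.
Proof. by have := thetas_itv (edge_of e); lra. Qed.

Lemma extK e : pi - ext e = thetas (edge_of e). Proof. by ring. Qed.

Lemma sum_total_angle g rho (F' : {set face S}) :
  \sum_(f in F') total_angle g rho f =
  \sum_(x in incident_edges F') 2 * edge_share F' (edge_angle g rho) x.
Proof. by rewrite -!mulr_sumr sum_over_faces. Qed.

Lemma edge_angle_opp g rho e : edge_angle g rho (opp e) =
  half_kite_angle g (ext e) (rho (right_face e)) (rho (left_face e)).
Proof. by rewrite /edge_angle edge_of_opp right_opp. Qed.

Lemma edge_angle_lt g rho e : edge_angle g rho e < thetas (edge_of e).
Proof. by rewrite -extK half_kite_angle_lt// ext_itv. Qed.

Lemma edge_angle_add g rho e : edge_angle g rho e + edge_angle g rho (opp e) =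
  thetas (edge_of e) - match g with Euclidean => 0 | Hyperbolic =>
    2 * tri_angle (ext e) (rho (left_face e) + rho (right_face e)) end.
Proof. by rewrite edge_angle_opp half_kite_angle_add ?extK// ext_itv. Qed.

Lemma edge_share_le g rho (F' : {set face S}) x : x \in incident_edges F' ->
  edge_share F' (edge_angle g rho) x <= thetas x.
Proof.
move=> /(edge_shareP (edge_angle g rho))[e [<- _] ->].
case: ifP => _; last by rewrite addr0 ltW// edge_angle_lt.
rewrite edge_angle_add; case: g; first by rewrite subr0.
by rewrite gerBl mulr_ge0// ltW// tri_angle_gt0.
Qed.

Lemma edge_share_hyp_lt rho (F' : {set face S}) x : x \in incident_edges F' ->
  edge_share F' (edge_angle Hyperbolic rho) x < thetas x.
Proof.
move=> /(edge_shareP (edge_angle Hyperbolic rho))[e [<- _] ->].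
case: ifP => _; last by rewrite addr0 edge_angle_lt.
by rewrite edge_angle_add ltrBlDr ltrDl mulr_gt0// tri_angle_gt0.
Qed.

Lemma edge_share_crossing_lt g rho (F' : {set face S}) e : left_face e \in F' ->
  right_face e \notin F' ->
  edge_share F' (edge_angle g rho) (edge_of e) < thetas (edge_of e).
Proof.
move=> eF /negP rF; have [e' [ee lF ->]] :=
  edge_shareP (edge_angle g rho) (in_incident_edges eF).
rewrite -ee; case: ifP => rF'; last by rewrite addr0 edge_angle_lt.
case: rF; have /edge_ofP[->//|->] : edge_of e' = edge_of e by [].
by rewrite right_opp.
Qed.

Lemma sum_total_angle_euc rho :
  \sum_f total_angle Euclidean rho f = \sum_x 2 * thetas x.
Proof.
rewrite (eq_bigl (mem [set: face S]%SET)) => [|f]; last by rewrite !inE.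
rewrite sum_total_angle; apply: eq_big => x.
  by have [e <-] := edge_of_surj x; rewrite in_incident_edges ?inE.
move=> /(edge_shareP (edge_angle Euclidean rho))[e [<- _] ->].
by rewrite inE edge_angle_add subr0.
Qed.

(** Positivity of the angles only serves to exclude faces without edges. *)
Lemma sum_total_angle_lt g rho (F' : {set face S}) : F' != finset.set0 ->
  (forall f, total_angle g rho f > 0) ->
  (g = Euclidean -> F' != [set: face S]%SET) ->
  \sum_(f in F') total_angle g rho f <
    \sum_(x in incident_edges F') 2 * thetas x.
Proof.
move=> F0 pos FT; rewrite sum_total_angle.
suff [e eF lt] : exists2 e, left_face e \in F' &
    edge_share F' (edge_angle g rho) (edge_of e) < thetas (edge_of e).
  rewrite (bigD1 (edge_of e)) ?in_incident_edges//=.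
  rewrite [ltRHS](bigD1 (edge_of e)) ?in_incident_edges//=.
  apply: ltr_leD; first by rewrite ltr_pM2l.
  by apply: ler_sum => x /andP[xF _]; rewrite ler_pM2l// edge_share_le.
case: g pos FT => [_ /(_ erefl)/(crossing_edge F0)[e eF rF]|pos _].
  by exists e => //; exact: edge_share_crossing_lt.
have /set0Pn[f fF] := F0.
have [e /eqP ef] : exists e, left_face e == f.
  apply: contrapT => no; have := pos f.
  rewrite /total_angle big1 ?mulr0 ?ltxx// => e ef.
  by case: no; exists e.
by exists e; rewrite ?ef// edge_share_hyp_lt// in_incident_edges// ef.
Qed.

(** If the circles of F' are small, and much smaller than those outside F', the
strict inequality that holds for all patterns is almost an equality. *)
Lemma sum_total_angle_gap g (F' : {set face S}) t : 0 < t -> exists2 M, 0 <= M &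
  forall M', M <= M' -> forall rho, (forall f, log_dom g (rho f)) ->
    (forall f, f \in F' -> rho f < - M') ->
    (forall f f', f \in F' -> f' \notin F' -> M' <= rho f' - rho f) ->
  \sum_(x in incident_edges F') 2 * thetas x - t <
    \sum_(f in F') total_angle g rho f.
Proof.
move=> t0; pose n : R := #|edge S|%:R.
have n0 : 0 <= n by rewrite ler0n.
(* Each of at most n edges may lose 2 * s. *)
pose s := t / (2 * (n + 1)).
have s0 : 0 < s by rewrite divr_gt0// mulr_gt0// ltr_wpDl.
have [|M M0 MP] := @common_bound R (oedge S) (fun e M => forall u v : R,
    log_dom g u -> log_dom g v -> u <= - M ->
    [/\ M <= v - u -> thetas (edge_of e) - s <= half_kite_angle g (ext e) u v
     & v <= - M -> thetas (edge_of e) - s <=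
        half_kite_angle g (ext e) u v + half_kite_angle g (ext e) v u]).
  move=> e; have [M M0 H] := half_kite_angle_limit g (ext_itv e) s0.
  exists M => // M' MM u v du dv uM.
  have [|H1 H2] := H u v du dv; first lra.
  by rewrite extK in H1 H2; split=> ?; [apply: H1|apply: H2]; lra.
exists M => // M' MM rho dom low gap; rewrite sum_total_angle.
have share x : x \in incident_edges F' ->
    2 * thetas x - 2 * s <= 2 * edge_share F' (edge_angle g rho) x.
  move=> /(edge_shareP (edge_angle g rho))[e [<- eF] ->].
  rewrite -mulrBr ler_pM2l//.
  have [H1 H2] := MP e M' MM _ _ (dom (left_face e)) (dom (right_face e))
    (ltW (low _ eF)).
  case: ifP => rF; first by rewrite edge_angle_opp; apply/H2/ltW/low.
  by rewrite addr0; apply/H1/gap; rewrite ?rF.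
apply: lt_le_trans; last by apply: ler_sum; exact: share.
rewrite sumrB ltrD2l ltrN2.
rewrite sumr_const -[_ *+ _]mulr_natl.
apply: (@le_lt_trans _ _ (n * (2 * s))).
  by apply: ler_wpM2r; rewrite ?ler_nat ?max_card// mulr_ge0// ltW.
rewrite /s (_ : n * _ = t * (n / (n + 1))); last by field; rewrite lt0r_neq0// ltr_wpDl.
by rewrite gtr_pMr// ltr_pdivrMr ?mul1r ?ltrDl// ltr_wpDl.
Qed.

Definition solvable_on (F' : {set face S}) :=
  \sum_(f in F') Phi f < \sum_(x in incident_edges F') 2 * thetas x.

(** Far below the ceiling there is a gap; the faces F' below it do not touch the
ceiling, so their angles are at most the prescribed ones, in contradiction to
[sum_total_angle_gap].  In the Euclidean case F' must be a proper subset, which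
is why some face has to touch the ceiling. *)
Lemma barrier_bounded g c : log_dom g c -> c <= 0 ->
    (forall F', F' != finset.set0 -> (g = Euclidean -> F' != [set: face S]%SET) ->
       solvable_on F') ->
  exists b, forall rho, barrier (total_angle g) Phi c rho ->
    (g = Euclidean -> exists f, rho f = c) -> forall f, b <= rho f.
Proof.
move=> dc c0 cond.
have [|M M0 MP] := @common_bound R {set face S} (fun F' M => F' != finset.set0 ->
    (g = Euclidean -> F' != [set: face S]%SET) ->
    forall rho, barrier (total_angle g) Phi c rho ->
      (forall f, f \in F' -> rho f < c - M) ->
      (forall f f', f \in F' -> f' \notin F' -> M <= rho f' - rho f) -> False).
  move=> F'.
  have [/andP[F0 FT]|no] := boolP ((F' != finset.set0) &&
      `[< g = Euclidean -> F' != [set: face S]%SET >]).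
    have {FT}FT := asboolP _ FT.
    have := cond F' F0 FT; rewrite /solvable_on -subr_gt0.
    move=> /(sum_total_angle_gap g F')[M M0 MP].
    exists M => // M' MM _ _ rho rho_b low gap.
    suff : \sum_(f in F') total_angle g rho f <= \sum_(f in F') Phi f.
      rewrite leNgt => /negP; apply.
      rewrite -[X in X < _](subKr (\sum_(x in incident_edges F') 2 * thetas x)).
      apply: (MP M' MM) => //.
      - move=> f; case: (rho_b f) => fc _; move: dc; case: (g) => //= c1.
        exact: le_lt_trans c1.
      - move=> f /low; lra.
    apply: ler_sum => f fF; case: (rho_b f) => _ [e|//].
    by have := low f fF; rewrite e; move: M0 MM; lra.
  (* For the other F' the claim is void. *)
  exists 0 => // M' _ F0 FT; case/negP: no; rewrite F0 /=; exact/asboolP.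
exists (c - M * (#|face S|.+1)%:R) => rho rho_b euc f; rewrite leNgt; apply/negP => low.
have [F' [F0 Flow gap]] := level_gap M0 low.
apply: (MP F' M (lexx _) F0 _ rho rho_b Flow gap) => /euc[f1 f1c].
apply/negP => /eqP FT; have := Flow f1; rewrite FT inE f1c => /(_ isT).
by move: M0; lra.
Qed.

Lemma total_angle_mono g c : log_dom g c -> forall rho rho' f,
  (forall h, rho h <= rho' h) -> (forall h, rho' h <= c) ->
  rho f = rho' f -> total_angle g rho f <= total_angle g rho' f.
Proof.
move=> dc rho rho' f le lec ef; rewrite /total_angle ler_pM2l//.
have dom h : log_dom g (rho' h).
  by move: dc; case: (g) => //=; apply: le_lt_trans.
apply: ler_sum => e /eqP ee; rewrite /edge_angle ee ef.
by apply: half_kite_angle_le; rewrite ?ext_itv.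
Qed.

Lemma total_angle_continuous g rho f :
  continuous (fun t => total_angle g (upd rho f t) f).
Proof.
move=> t; apply: cvgMr; apply: cvg_big; first exact: add_continuous.
move=> e /eqP ee; rewrite /edge_angle /upd ee eqxx.
have := @half_kite_angle_continuous R g (ext e)
  (fun t => if right_face e == f then t else rho (right_face e)).
by apply; case: eqP => _ u; [exact: cvg_id|exact: cvg_cst].
Qed.

(** The ceiling is chosen so close to 0, that is, the circles so large, that two
equal circles at the ceiling have tiny half angles. *)
Lemma exists_hyperbolic_radii : (forall f, 0 < Phi f) ->
    (forall F', F' != finset.set0 -> solvable_on F') ->
  exists2 rho, (forall f, rho f < 0) & forall f, total_angle Hyperbolic rho f = Phi f.
Proof.
move=> Phi0 cond.
pose n : R := #|oedge S|%:R.
have n0 : 0 <= n by rewrite ler0n.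
have [|M M0 MP] := @common_bound R (oedge S) (fun e M =>
   let c := - (1 + M)^-1 in
   half_kite_angle Hyperbolic (ext e) c c < Phi (left_face e) / (2 * (n + 1))).
  move=> e; set t := _ / _.
  have t0 : 0 < t by rewrite divr_gt0// mulr_gt0// ltr_wpDl.
  have : (\forall c \near (0:R), half_kite_angle Hyperbolic (ext e) c c < t)%classic.
    have := @half_kite_angle_continuous R Hyperbolic (ext e) id (fun u => cvg_id) 0.
    by move=> /cvgr_lt; apply; rewrite /= subr0 addr0 subrr.
  move=> /nbhs_ballP [d /= d0 Hd].
  exists d^-1; first by rewrite ltW// invr_gt0.
  move=> M dM /=; apply: Hd; rewrite /ball/= sub0r opprK.
  have dV : 0 < d^-1 by rewrite invr_gt0.
  rewrite ger0_norm ?invr_ge0; last lra.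
  by rewrite invf_plt ?posrE//; lra.
pose c := - (1 + M)^-1.
have c0 : c < 0 by rewrite oppr_lt0 invr_gt0; lra.
have [|b bP] := @barrier_bounded Hyperbolic c c0 (ltW c0).
  by move=> F' F0 _; exact: cond.
have [|||rho rho_b ge] := @perron R (face S) (total_angle Hyperbolic) Phi b c.
- exact: total_angle_mono.
- exact: total_angle_continuous.
- by move=> rho /bP; apply.
exists rho => f; first by case: (rho_b f) => fc _; exact: le_lt_trans fc c0.
apply/le_anti; rewrite ge andbT; case: (rho_b f) => _ [fc|//].
apply: (@le_trans _ _ (2 * \sum_(e : oedge S) Phi f / (2 * (n + 1)))).
  rewrite ler_pM2l// [leRHS](bigID (fun e => left_face e == f))/=.
  apply: ler_wpDr.
    by apply: sumr_ge0 => e _; rewrite divr_ge0 ?ltW// mulr_gt0// ltr_wpDl.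
  apply: ler_sum => e /eqP ef; rewrite /edge_angle -ef in fc *; rewrite fc.
  apply/ltW; apply: le_lt_trans (MP e M (lexx _)).
  apply: (half_kite_angle_le (g := Hyperbolic) (x := c)
    (y := rho (right_face e)) (y' := c) (ext_itv e)) => //.
  by case: (rho_b (right_face e)).
rewrite (_ : \sum_(e : oedge S) _ = n * (Phi f / (2 * (n + 1)))); last first.
  by rewrite sumr_const -[LHS]mulr_natl.
rewrite (_ : 2 * (n * _) = Phi f * (n / (n + 1))); last by field; rewrite lt0r_neq0// ltr_wpDl.
by rewrite ler_piMr ?ltW// ltr_pdivrMr ?mul1r ?ltrDl// ltr_wpDl.
Qed.

Lemma exists_euclidean_radii :
    \sum_f Phi f = \sum_x 2 * thetas x ->
    (forall F', F' != finset.set0 -> F' != [set: face S]%SET -> solvable_on F') ->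
  exists rho, forall f, total_angle Euclidean rho f = Phi f.
Proof.
move=> eqT cond.
have sum_eq (u v : face S -> R) :
    \sum_f u f = \sum_f v f -> (forall f, u f <= v f) ->
    forall f, u f = v f.
  move=> uv le f; apply/eqP; rewrite eq_sym -subr_eq0; apply/eqP.
  have : \sum_f (v f - u f) = 0 by rewrite sumrB uv subrr.
  move=> /eqP; rewrite psumr_eq0 => [|h _]; last by rewrite subr_ge0.
  by move=> /allP/(_ f (mem_index_enum _))/eqP.
have [[rho rho_b no]|all_touch] := EM (exists2 rho,
    barrier (total_angle Euclidean) Phi 0 rho & forall f, rho f <> 0).
  exists rho; apply: sum_eq; first by rewrite eqT sum_total_angle_euc.
  by move=> f; case: (rho_b f) => _ [/no|].
have [|b bP] := @barrier_bounded Euclidean 0 I (lexx _).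
  by move=> F' F0 /(_ erefl); exact: cond.
have [|||rho rho_b ge] := @perron R (face S) (total_angle Euclidean) Phi b 0.
- exact: total_angle_mono.
- exact: total_angle_continuous.
- move=> rho rho_b; apply: bP => // _; apply: contrapT => no; apply: all_touch.
  by exists rho => // f f0; apply: no; exists f.
exists rho => f; apply/esym; apply: sum_eq f => //.
by rewrite eqT sum_total_angle_euc.
Qed.

(** Maximum principle: at a face where rho' - rho is maximal and positive every
half angle would be strictly smaller for rho'. *)
Lemma hyperbolic_radii_le rho rho' : (forall f, 0 < total_angle Hyperbolic rho f) ->
    (forall f, rho f < 0) -> (forall f, rho' f < 0) ->
    (forall f, total_angle Hyperbolic rho f <= total_angle Hyperbolic rho' f) ->
  forall f, rho' f <= rho f.
Proof.
move=> pos neg neg' le f0; pose d f := rho' f - rho f.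
case: (@arg_maxP _ _ _ f0 predT d isT) => f _ fmax.
rewrite -subr_le0; apply: le_trans (fmax f0 isT) _; rewrite leNgt; apply/negP => df.
have := le f; rewrite leNgt => /negP; apply.
rewrite /total_angle ltr_pM2l//.
have [e0 ef] : exists e, left_face e == f.
  apply: contrapT => no; have := pos f.
  rewrite /total_angle big1 ?mulr0 ?ltxx// => e ef.
  by case: no; exists e.
apply: ltr_sum; first by apply/hasP; exists e0; rewrite ?mem_index_enum.
move=> e /eqP ee; rewrite /edge_angle ee.
apply: half_kite_angle_shift; rewrite ?ext_itv//; first by rewrite -subr_gt0.
exact: fmax.
Qed.

(** Maximum principle: at a face where rho' - rho is maximal no half angle is
larger for rho', so that all of them agree and the maximum is taken by all
neighbours too. *)
Lemma euclidean_radii_unique rho rho' :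
    (forall f, total_angle Euclidean rho f = total_angle Euclidean rho' f) ->
  exists d, forall f, rho' f = rho f + d.
Proof.
move=> eqA; have /card_gt0P[f0 _] := face_nonempty S.
pose d f := rho' f - rho f.
case: (@arg_maxP _ _ _ f0 predT d isT) => f1 _ fmax.
exists (d f1); pose F' := [set f | d f == d f1]%SET.
suff FT : F' = [set: face S]%SET.
  move=> f; have : f \in F' by rewrite FT finset.in_setT.
  by rewrite inE => /eqP <-; rewrite /d; ring.
apply: contrapT => /eqP FT.
have [|e] := @crossing_edge _ F' _ FT.
  by apply/set0Pn; exists f1; rewrite inE.
rewrite !inE => /eqP ld rd.
have := eqA (left_face e); apply/eqP; rewrite gt_eqF// /total_angle ltr_pM2l//.
have le e' : left_face e' = left_face e ->
    edge_angle Euclidean rho' e' <= edge_angle Euclidean rho e'.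
  move=> ee; rewrite /edge_angle /= ee tri_angle_le ?ext_itv//.
  by have := fmax (right_face e') isT; rewrite -ld /d /=; lra.
rewrite (bigD1 e)//= [ltRHS](bigD1 e)//=; apply: ltr_leD.
  rewrite /edge_angle/= tri_angle_incr ?ext_itv//.
  have : d (right_face e) < d (left_face e).
    by rewrite lt_neqAle ld rd; exact: fmax.
  by rewrite /d; lra.
by apply: ler_sum => e' /andP[/eqP ee _]; exact: le.
Qed.

End Solve.

(** * Rigid motions and the law of cosines *)

Section Plane.
Context {R : realType}.
Local Open Scope complex_scope.
Local Notation normc := (@Normc.normc R).
Local Notation Re := (@complex.Re R).
Local Notation Im := (@complex.Im R).
Implicit Types (g : geometry) (a c p l r u v x y z : R[i]) (t theta : R).

Lemma conjM x y : conjc (x * y) = conjc x * conjc y. Proof. exact: rmorphM. Qed.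
Lemma conjB x y : conjc (x - y) = conjc x - conjc y. Proof. exact: rmorphB. Qed.
Lemma conj1 : conjc (1 : R[i]) = 1. Proof. exact: rmorph1. Qed.
Lemma conjN x : conjc (- x) = - conjc x. Proof. exact: rmorphN. Qed.

Lemma normc_ge0 z : 0 <= normc z.
Proof. by case: z => a b; rewrite sqrtr_ge0. Qed.

Lemma sqr_normcE z : normc z ^+ 2 = Re z ^+ 2 + Im z ^+ 2.
Proof. by case: z => a b; rewrite sqr_sqrtr// addr_ge0// sqr_ge0. Qed.

Lemma normc_conjc z : normc (conjc z) = normc z.
Proof. by case: z => a b /=; rewrite sqrrN. Qed.

Lemma normcB_sym x y : normc (x - y) = normc (y - x).
Proof. by case: x y => a b [c d] /=; congr Num.sqrt; ring. Qed.

Lemma normc0 : normc 0 = 0. Proof. exact: Normc.normc0. Qed.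

Lemma normc1 : normc 1 = 1. Proof. exact: Normc.normc1. Qed.

Lemma normc_eq0 z : (normc z == 0) = (z == 0).
Proof.
apply/eqP/eqP => [|->]; first exact: Normc.eq0_normc.
exact: Normc.normc0.
Qed.

Lemma normc_gt0 z : (0 < normc z) = (z != 0).
Proof. by rewrite lt0r normc_ge0 andbT normc_eq0. Qed.

Lemma mul_conjc z : z * conjc z = (normc z ^+ 2)%:C.
Proof. by rewrite sqr_normcE; case: z => a b; simpc; congr (_ +i* _); ring. Qed.

Lemma disc_den_neq0 c x : normc c < 1 -> normc x < 1 -> 1 - conjc c * x != 0.
Proof.
move=> c1 x1; rewrite subr_eq0; apply/eqP => e.
have : normc (conjc c * x) = 1 by rewrite -e normc1.
rewrite Normc.normcM normc_conjc; apply/eqP; rewrite lt_eqF//.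
by rewrite mulr_ilt1 ?normc_ge0.
Qed.

Lemma seen_from0 g x : seen_from g 0 x = x.
Proof. by case: g; rewrite /seen_from ?conjc0 ?mul0r ?subr0 ?divr1. Qed.

Lemma seen_from_self g c : seen_from g c c = 0.
Proof. by case: g; rewrite /seen_from subrr ?mul0r. Qed.

Lemma plane0 g : plane g (0 : R[i]).
Proof. by case: g => //; rewrite /plane /mkset normc0. Qed.

Lemma plane_seen_from g c x : plane g c -> plane g x -> plane g (seen_from g c x).
Proof.
case: g => //= c1 x1; have den := disc_den_neq0 c1 x1.
rewrite Normc.normcM Normc.normcV ltr_pdivrMr ?normc_gt0// mul1r.
rewrite -(@ltr_pXn2r _ 2) ?nnegrE ?normc_ge0// -subr_gt0.
have -> : normc (1 - conjc c * x) ^+ 2 - normc (x - c) ^+ 2 =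
          (1 - normc c ^+ 2) * (1 - normc x ^+ 2).
  by rewrite !sqr_normcE; case: c x {c1 x1 den} => a b [d e] /=; ring.
by rewrite mulr_gt0// subr_gt0 expr_lt1 ?normc_ge0.
Qed.

Lemma planeN g c : plane g c -> plane g (- c).
Proof. by case: g => //=; rewrite -[- c]sub0r normcB_sym subr0. Qed.

Lemma seen_from_sym g c x : normc (seen_from g c x) = normc (seen_from g x c).
Proof.
case: g => /=; first exact: normcB_sym.
rewrite !Normc.normcM !Normc.normcV normcB_sym; congr (_ / _).
by rewrite -normc_conjc conjB conjM conj1 conjcK mulrC.
Qed.

Lemma seen_fromK g c x : plane g c -> plane g x ->
  seen_from g (- c) (seen_from g c x) = x.
Proof.
case: g => /= c1 x1; first by rewrite opprK subrK.
have den := disc_den_neq0 c1 x1; have dcc := disc_den_neq0 c1 c1.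
rewrite conjN opprK mulNr opprK.
have -> : (x - c) / (1 - conjc c * x) + c =
    x * ((1 - conjc c * c) / (1 - conjc c * x)) by field.
have -> : 1 + conjc c * ((x - c) / (1 - conjc c * x)) =
    (1 - conjc c * c) / (1 - conjc c * x) by field.
by rewrite mulfK// mulf_neq0// invr_neq0.
Qed.

(** Orientation-preserving isometries, seen from a center: up to a rotation
about the origin, the view from h c is the view from c. *)
Definition rigid g (h : R[i] -> R[i]) :=
  [/\ forall x, plane g x -> plane g (h x) &
   forall c, plane g c -> exists2 eta, normc eta = 1 &
     forall x, plane g x -> seen_from g (h c) (h x) = eta * seen_from g c x].

Lemma rigid_seen_from g p : plane g p -> rigid g (seen_from g p).
Proof.
move=> pp; split; first by move=> x; exact: plane_seen_from.
case: g pp => /= p1 c c1.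
  by exists 1 => [|x _]; [exact: normc1|rewrite mul1r; ring].
have dpc := disc_den_neq0 p1 c1; have dcp := disc_den_neq0 c1 p1.
exists ((1 - conjc c * p) / (1 - conjc p * c)).
  rewrite Normc.normcM Normc.normcV -[X in X / _]normc_conjc.
  rewrite conjB conjM conj1 conjcK [c * _]mulrC divff//.
  by rewrite normc_eq0.
move=> x x1; have dpx := disc_den_neq0 p1 x1; have dcx := disc_den_neq0 c1 x1.
have dpp := disc_den_neq0 p1 p1.
have -> : conjc ((c - p) / (1 - conjc p * c)) = (conjc c - conjc p) / (1 - p * conjc c).
  by rewrite conjM conjc_inv !conjB conjM conj1 conjcK.
rewrite [conjc c * p]mulrC in dcp *.
have -> : 1 - (conjc c - conjc p) / (1 - p * conjc c) * ((x - p) / (1 - conjc p * x))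
  = (1 - conjc p * p) * (1 - conjc c * x) / ((1 - p * conjc c) * (1 - conjc p * x)).
  by field; rewrite dcp dpx.
have -> : (x - p) / (1 - conjc p * x) - (c - p) / (1 - conjc p * c) =
  (1 - conjc p * p) * (x - c) / ((1 - conjc p * c) * (1 - conjc p * x)).
  by field; rewrite dpc dpx.
by field; rewrite dpc dpx dcp dcx dpp.
Qed.

Lemma rigid_rotation g mu : normc mu = 1 -> rigid g (fun x => mu * x).
Proof.
move=> mu1; split.
  by case: g => //= x x1; rewrite Normc.normcM mu1 mul1r.
move=> c pc; exists mu => // x px; case: g pc px => /= ? ?; first by rewrite mulrBr.
rewrite conjM mulrACA [conjc mu * _]mulrC mul_conjc mu1 expr1n mul1r.
by rewrite -mulrBr mulrA.
Qed.

Lemma rigid_comp g h k : rigid g h -> rigid g k -> rigid g (fun x => h (k x)).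
Proof.
move=> [hp hs] [kp ks]; split=> [x /kp/hp//|c pc].
have [e1 n1 H1] := ks c pc; have [e2 n2 H2] := hs _ (kp _ pc).
exists (e2 * e1) => [|x px]; first by rewrite Normc.normcM n1 n2 mulr1.
by rewrite H2 ?H1 ?mulrA//; exact: kp.
Qed.

Section RigidInvariance.
Variables (g : geometry) (h : R[i] -> R[i]) (hr : rigid g h).

Lemma rigid_plane x : plane g x -> plane g (h x).
Proof. by case: hr => + _; apply. Qed.

Lemma rigid_normc c x : plane g c -> plane g x ->
  normc (seen_from g (h c) (h x)) = normc (seen_from g c x).
Proof.
case: hr => _ hs pc px; have [e n ->//] := hs c pc.
by rewrite Normc.normcM n mul1r.
Qed.

Lemma rigid_dist c x : plane g c -> plane g x -> dist g (h c) (h x) = dist g c x.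
Proof. by move=> pc px; rewrite /dist rigid_normc. Qed.

Lemma rigid_seenM c x y : plane g c -> plane g x -> plane g y ->
  seen_from g (h c) (h x) * conjc (seen_from g (h c) (h y)) =
  seen_from g c x * conjc (seen_from g c y).
Proof.
case: hr => _ hs pc px py; have [e n E] := hs c pc.
by rewrite !E// conjM mulrACA mul_conjc n expr1n mul1r.
Qed.

Lemma rigid_angle c x y : plane g c -> plane g x -> plane g y ->
  angle g (h c) (h x) (h y) = angle g c x y.
Proof. by move=> pc px py; rewrite /angle rigid_seenM// !rigid_normc. Qed.

Lemma rigid_on_left c x y : plane g c -> plane g x -> plane g y ->
  on_left g (h c) (h x) (h y) <-> on_left g c x y.
Proof.
by move=> pc px py; rewrite /on_left ![conjc _ * _]mulrC rigid_seenM.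
Qed.

End RigidInvariance.

Lemma seen_from_conjc g c x :
  seen_from g (conjc c) (conjc x) = conjc (seen_from g c x).
Proof.
by case: g; rewrite /seen_from ?conjM ?conjc_inv ?conjB ?conjM ?conj1.
Qed.

(** Numerator and denominator of the cotangent of the half angle in terms of the
moduli tl, tr of the left and right radius, that is, of r or tanh (r / 2). *)
Definition apex_cot_num g theta tl tr : R :=
  match g with
  | Euclidean => tl / tr - cos theta
  | Hyperbolic => tl * (tr^-1 + tr) - (1 + tl ^+ 2) * cos theta
  end.

Definition apex_cot_den g theta tl : R :=
  match g with
  | Euclidean => sin theta
  | Hyperbolic => sin theta * (1 - tl ^+ 2)
  end.

Definition valid_modulus g t :=
  0 < t /\ match g with Euclidean => True | Hyperbolic => t < 1 end.

Lemma half_kite_angle_acot g theta tl tr : 0 < theta < pi ->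
    valid_modulus g tl -> valid_modulus g tr ->
  half_kite_angle g theta (ln tl) (ln tr) =
  acot (apex_cot_num g theta tl tr / apex_cot_den g theta tl).
Proof.
move=> th [l0 l1] [r0 r1]; case: g l1 r1 => l1 r1 /=.
  by rewrite /tri_angle opprB expRD expRN !lnK.
by rewrite -/(half_kite_angle Hyperbolic _ _ _) half_kite_angle_hyp ?expRN ?lnK// ln_lt0 ?l0.
Qed.

(** Transfers a triangle from the view of its vertex 0 to that of its vertex u:
the left hand side has the angle at u as its argument. *)
Lemma seen_originE g u v : plane g u -> plane g v ->
  seen_from g u 0 * conjc (seen_from g u v) =
  match g with
  | Euclidean => (normc u ^+ 2)%:C - u * conjc v
  | Hyperbolic => ((normc u ^+ 2)%:C - u * conjc v) * (1 - conjc u * v) *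
                  ((normc (1 - conjc u * v) ^+ 2)^-1)%:C
  end.
Proof.
case: g => /= pu pv; first by rewrite -mul_conjc conjB; ring.
have den := disc_den_neq0 pu pv.
have denc : 1 - u * conjc v != 0.
  by rewrite -conjc_eq0 conjB conj1 conjM conjcK.
have -> : ((normc (1 - conjc u * v) ^+ 2)^-1)%:C =
    ((1 - conjc u * v) * conjc (1 - conjc u * v))^-1.
  by rewrite mul_conjc; exact: fmorphV.
rewrite -mul_conjc conjM conjc_inv !conjB conj1 conjM conjcK.
by field; rewrite den denc.
Qed.

(** In the hyperbolic case the denominator is |1 - conj u * v|^2 for points u,
v of moduli tl, tr that are seen from the origin under the angle theta. *)
Definition apex_scale g theta tl tr : R :=
  match g with
  | Euclidean => tl * tr
  | Hyperbolic => tl * tr / (1 - 2 * (tl * tr) * cos theta + (tl * tr) ^+ 2)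
  end.

Lemma apex_scale_gt0 g theta tl tr : 0 < theta < pi -> 0 < tl -> 0 < tr ->
  0 < apex_scale g theta tl tr.
Proof.
move=> th l0 r0; have s0 := sin_gt0_pi th.
case: g; rewrite /apex_scale ?divr_gt0 ?mulr_gt0//.
have -> : 1 - 2 * (tl * tr) * cos theta + (tl * tr) ^+ 2 =
    (1 - tl * tr * cos theta) ^+ 2 + (tl * tr * sin theta) ^+ 2.
  by rewrite [in RHS]exprMn -[sin theta ^+ 2](addKr (cos theta ^+ 2)) cos2Dsin2; ring.
by apply: ltr_wpDl; rewrite ?sqr_ge0// exprn_gt0// !mulr_gt0.
Qed.

(** The law of cosines for the triangle 0, u, v with angle theta at 0: the angle
at u is the argument of the right hand side. *)
Lemma apex_product_origin g theta tl tr u v : 0 < theta < pi ->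
    plane g u -> plane g v -> normc u = tl -> normc v = tr -> 0 < tl -> 0 < tr ->
    Re (u * conjc v) = tl * tr * cos theta -> 0 < Im (conjc u * v) ->
  seen_from g u 0 * conjc (seen_from g u v) =
  (apex_scale g theta tl tr)%:C *
  (apex_cot_num g theta tl tr +i* apex_cot_den g theta tl).
Proof.
move=> th pu pv ul vr l0 r0 Rw Iw; have s0 := sin_gt0_pi th.
have Ew : u * conjc v = (tl * tr)%:C * (cos theta -i* sin theta).
  have Im_w : Im (u * conjc v) = - (tl * tr * sin theta).
    have : (Im (u * conjc v)) ^+ 2 = (tl * tr * sin theta) ^+ 2.
      have := sqr_normcE (u * conjc v).
      rewrite Normc.normcM normc_conjc ul vr Rw => /eqP; rewrite addrC -subr_eq => /eqP <-.
      by rewrite !exprMn -[cos theta ^+ 2](addrK (sin theta ^+ 2)) cos2Dsin2; ring.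
    move=> /eqP; rewrite eqf_sqr => /orP[|] /eqP // E; exfalso.
    have : Im (u * conjc v) = - Im (conjc u * v).
      by case: (u) (v) => a b [c d] /=; ring.
    have : 0 < tl * tr * sin theta by rewrite !mulr_gt0.
    by rewrite -E => + E'; rewrite E'; move: Iw; lra.
  rewrite [LHS]complexE Rw Im_w; simpc; congr (_ +i* _); ring.
have Ewc : conjc u * v = (tl * tr)%:C * (cos theta +i* sin theta).
  by rewrite -[LHS]conjcK conjM conjcK Ew; simpc.
rewrite seen_originE// Ew Ewc ul; case: g pu pv => /= pu pv.
  by simpc; congr (_ +i* _); field; rewrite ?lt0r_neq0.
set D := 1 - 2 * (tl * tr) * cos theta + (tl * tr) ^+ 2.
have -> : normc (1 - (tl * tr)%:C * (cos theta +i* sin theta)) ^+ 2 = D.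
  rewrite sqr_normcE; simpc => /=; rewrite sqrrN [in X in _ + X]exprMn.
  by rewrite -[sin theta ^+ 2](addKr (cos theta ^+ 2)) cos2Dsin2 /D; ring.
have D0 : D != 0.
  have := apex_scale_gt0 Hyperbolic th l0 r0; rewrite /apex_scale -/D.
  by apply: contraTneq => ->; rewrite invr0 mulr0 ltxx.
simpc; congr (_ +i* _); last by field.
(* The two sides differ by a multiple of cos^2 + sin^2 - 1. *)
apply/eqP; rewrite -subr_eq0; apply/eqP.
transitivity ((tl * tr) ^+ 2 / D * (cos theta ^+ 2 + sin theta ^+ 2 - 1)).
  by field; rewrite D0 lt0r_neq0.
by rewrite cos2Dsin2 subrr mulr0.
Qed.

(** The orientation of a triangle does not depend on the vertex from which it is
read off.  A rigid motion takes y to the origin, where this is a computation. *)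
Lemma on_left_cycle g c x y : plane g c -> plane g x -> plane g y ->
  on_left g c x y -> on_left g y c x.
Proof.
move=> pc px py.
have yr := rigid_seen_from py.
rewrite -(rigid_on_left yr pc px py) -(rigid_on_left yr py pc px) seen_from_self.
rewrite /on_left !seen_from0; move: (rigid_plane yr pc) (rigid_plane yr px).
move: (seen_from g y c) (seen_from g y x) => u v pu pv.
rewrite mulrC seen_originE//; case: g pu pv {pc px py yr} => /= pu pv.
  by case: u v {pu pv} => a b [d e] /=; lra.
have den := disc_den_neq0 pu pv.
rewrite [_ * _%:C]mulrC; set n := _^-1.
have n0 : 0 < n by rewrite invr_gt0 exprn_gt0// normc_gt0.
have -> : Im (n%:C * (((normc u ^+ 2)%:C - u * conjc v) * (1 - conjc u * v))) =
   n * (1 - normc u ^+ 2) * Im (conjc u * v).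
  by rewrite sqr_normcE; case: (u) (v) => a b [d e] /=; ring.
have nu : 0 < 1 - normc u ^+ 2 by rewrite subr_gt0 expr_lt1 ?normc_ge0.
by rewrite pmulr_rgt0// mulr_gt0.
Qed.

Lemma cos_angle g p l r : plane g p -> 
  0 < normc (seen_from g p l) -> 0 < normc (seen_from g p r) ->
  Re (seen_from g p l * conjc (seen_from g p r)) =
    normc (seen_from g p l) * normc (seen_from g p r) * cos (angle g p l r).
Proof.
move=> pp; rewrite /angle; set u := seen_from g p l; set v := seen_from g p r => u0 v0.
have uv0 : 0 < normc u * normc v by rewrite mulr_gt0.
rewrite acosK; first by rewrite [RHS]mulrC divfK ?lt0r_neq0.
rewrite in_itv/= -ler_norml normf_div (gtr0_norm uv0).
rewrite ler_pdivrMr// mul1r -(@ler_pXn2r _ 2) ?nnegrE ?normr_ge0 ?(ltW uv0)//.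
rewrite -[normc v]normc_conjc -Normc.normcM sqr_normcE real_normK ?num_real//.
by rewrite lerDl sqr_ge0.
Qed.

(** Half a kite: l and r are the centers, p is the target of the edge. *)
Lemma apex_product g theta tl tr p l r : 0 < theta < pi ->
    plane g p -> plane g l -> plane g r ->
    normc (seen_from g l p) = tl -> normc (seen_from g r p) = tr ->
    0 < tl -> 0 < tr -> angle g p l r = theta -> on_left g l r p ->
  seen_from g l p * conjc (seen_from g l r) =
  (apex_scale g theta tl tr)%:C *
  (apex_cot_num g theta tl tr +i* apex_cot_den g theta tl).
Proof.
move=> th pp pl pr lE rE l0 r0 ang left.
have hr := rigid_seen_from pp.
rewrite -(rigid_seenM hr pl pp pr) seen_from_self.
rewrite seen_from_sym in lE; rewrite seen_from_sym in rE.
apply: apex_product_origin => //; try exact: rigid_plane.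
  by rewrite cos_angle ?lE ?rE ?ang.
by have := on_left_cycle pl pr pp left.
Qed.

Lemma half_angle_kite g theta tl tr p l r : 0 < theta < pi ->
    plane g p -> plane g l -> plane g r ->
    normc (seen_from g l p) = tl -> normc (seen_from g r p) = tr ->
    valid_modulus g tl -> valid_modulus g tr ->
    angle g p l r = theta -> on_left g l r p ->
  angle g l p r = half_kite_angle g theta (ln tl) (ln tr).
Proof.
move=> th pp pl pr lE rE vl vr ang left.
have [l0 _] := vl; have [r0 _] := vr; have s0 := sin_gt0_pi th.
have K := apex_product th pp pl pr lE rE l0 r0 ang left.
rewrite half_kite_angle_acot// /angle -[X in _ / (_ * X)]normc_conjc -Normc.normcM K.
set k := apex_scale _ _ _ _; set X := apex_cot_num _ _ _ _; set Y := apex_cot_den _ _ _.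
have k0 : 0 < k by exact: apex_scale_gt0.
have Y0 : 0 < Y.
  rewrite /Y; case: (g) vl => //= -[_ l1].
  by rewrite mulr_gt0// subr_gt0 expr_lt1// ltW.
have [sa ca] := acotP (X / Y).
rewrite Normc.normcM -/k; simpc; rewrite /= expr0n/= addr0 sqrtr_sqr gtr0_norm//.
rewrite -mulf_div divff ?lt0r_neq0// mul1r.
apply: acos_polar; rewrite ?acot_gt0 ?acot_ltpi//.
by rewrite ca mulrC mulrAC divfK ?lt0r_neq0.
Qed.

End Plane.

(** * Existence and similarity of kites *)

Section Kites.
Context {R : realType}.
Local Open Scope complex_scope.
Local Notation normc := (@Normc.normc R).
Local Notation Re := (@complex.Re R).
Local Notation Im := (@complex.Im R).
Implicit Types (g : geometry) (a c p u v x y z : R[i]).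
Implicit Types (t theta rl rr : R) (k : kite R).

(** The Euclidean distance from the origin of a point at distance r from it. *)
Definition modulus g (r : R) : R :=
  match g with Euclidean => r | Hyperbolic => (expR r - 1) / (expR r + 1) end.

Definition radius_of g t : R :=
  match g with Euclidean => t | Hyperbolic => ln ((1 + t) / (1 - t)) end.

Lemma modulus_valid g (r : R) : 0 < r -> valid_modulus g (modulus g r).
Proof.
case: g => //= r0; have er : 1 < expR r by rewrite expR_gt1.
have e0 : 0 < expR r + 1 by lra.
by split=> /=; [rewrite divr_gt0 ?subr_gt0|rewrite ltr_pdivrMr//; lra].
Qed.

Lemma modulusK g (r : R) : 0 < r -> radius_of g (modulus g r) = r.
Proof.
case: g => //= r0; have er := expR_gt0 r.
rewrite (_ : _ / _ = expR r) ?expRK//.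
by field; apply/andP; split; apply/eqP; lra.
Qed.

Lemma radius_ofK g t :
    0 <= t -> match g with Euclidean => True | Hyperbolic => t < 1 end ->
  modulus g (radius_of g t) = t.
Proof.
case: g => //= t0 t1; rewrite lnK ?posrE ?divr_gt0 ?subr_gt0//; last lra.
by field; apply/andP; split; apply/eqP; lra.
Qed.

Lemma radius_of_gt0 g t : valid_modulus g t -> 0 < radius_of g t.
Proof.
case: g => -[t0 t1] //=; rewrite ln_gt0// ltr_pdivlMr ?subr_gt0//; lra.
Qed.

Lemma distE g c x : dist g c x = radius_of g (normc (seen_from g c x)).
Proof. by case: g. Qed.

Lemma dist_modulus g c x (r : R) : plane g c -> plane g x -> dist g c x = r ->
  normc (seen_from g c x) = modulus g r.
Proof.
move=> pc px <-; rewrite distE radius_ofK ?normc_ge0//.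
by have := plane_seen_from pc px; case: g {pc px}.
Qed.

Lemma plane_conjc g x : plane g x -> plane g (conjc x).
Proof. by case: g => //=; rewrite normc_conjc. Qed.

Lemma dist_conjc g c x : dist g (conjc c) (conjc x) = dist g c x.
Proof. by rewrite !distE seen_from_conjc normc_conjc. Qed.

Lemma dist_sym g c x : dist g c x = dist g x c.
Proof. by rewrite !distE seen_from_sym. Qed.

Lemma angle_conjc g c x y : angle g (conjc c) (conjc x) (conjc y) = angle g c x y.
Proof.
rewrite /angle !seen_from_conjc !normc_conjc -conjM; congr (acos (_ / _)).
by case: (_ * _).
Qed.

Lemma angle_sym g c x y : angle g c x y = angle g c y x.
Proof.
rewrite /angle [_ * normc _]mulrC; congr (acos (_ / _)).
by case: (seen_from g c x) (seen_from g c y) => a b [d e] /=; ring.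
Qed.

(** Complex conjugation reverses the orientation. *)
Lemma on_left_conjc g c x y : on_left g (conjc c) (conjc x) (conjc y) <-> on_left g c y x.
Proof.
rewrite /on_left !seen_from_conjc conjcK mulrC.
by [].
Qed.

Lemma kite_oppK : involutive (@kite_opp R).
Proof. by case. Qed.

Lemma is_kite_opp g rl rr theta k :
  is_kite g rl rr theta k -> is_kite g rr rl theta (kite_opp k).
Proof.
case=> -[pl pr ps pt] [ls lt] [rs rt] [as_ at_] [ol os].
split; rewrite //= ?[angle _ _ (rcenter k) _]angle_sym//.
split; first exact: on_left_cycle os.
by do 2!apply: on_left_cycle => //.
Qed.

(** The position of the target relative to the axis of a kite. As it depends
only on the radii and on theta, so does the shape of the kite. *)
Definition kite_invariant g theta tl tr : R[i] :=
  (apex_scale g theta tl tr)%:C *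
  (apex_cot_num g theta tl tr +i* apex_cot_den g theta tl).

Section KiteInvariant.
Variables (g : geometry) (rl rr theta : R) (k : kite R).
Hypotheses (th : 0 < theta < pi) (l0 : 0 < rl) (r0 : 0 < rr).
Hypothesis kk : is_kite g rl rr theta k.
Let tl := modulus g rl.
Let tr := modulus g rr.

Lemma kite_half_angle : angle g (lcenter k) (target k) (rcenter k) =
  half_kite_angle g theta (ln tl) (ln tr).
Proof.
case: kk => -[pl pr ps pt] [ls lt] [rs rt] [as_ at_] [ol os].
apply: half_angle_kite => //; try exact: dist_modulus; exact: modulus_valid.
Qed.

Lemma kite_target_product :
  seen_from g (lcenter k) (target k) * conjc (seen_from g (lcenter k) (rcenter k)) =
  kite_invariant g theta tl tr.
Proof.
case: kk => -[pl pr ps pt] [ls lt] [rs rt] [as_ at_] [ol os].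
have [tl0 _] := modulus_valid g l0; have [tr0 _] := modulus_valid g r0.
by apply: apex_product => //; exact: dist_modulus.
Qed.

(** The source is the mirror image of the target in the axis. *)
Lemma kite_source_product :
  seen_from g (lcenter k) (source k) * conjc (seen_from g (lcenter k) (rcenter k)) =
  conjc (kite_invariant g theta tl tr).
Proof.
case: kk => -[pl pr ps pt] [ls lt] [rs rt] [as_ at_] [ol os].
rewrite /kite_invariant -(@apex_product _ g theta tl tr (conjc (source k))
  (conjc (lcenter k)) (conjc (rcenter k))) //.
- by rewrite !seen_from_conjc conjM !conjcK.
- exact: plane_conjc.
- exact: plane_conjc.
- exact: plane_conjc.
- by apply: dist_modulus; rewrite ?dist_conjc//; exact: plane_conjc.
- by apply: dist_modulus; rewrite ?dist_conjc//; exact: plane_conjc.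
- by case: (modulus_valid g l0).
- by case: (modulus_valid g r0).
- by rewrite angle_conjc.
- exact/on_left_conjc.
Qed.

End KiteInvariant.

(** A triangle u, v, 0 with the angle theta at 0 is easy to write down. The
motion m takes u to the origin and v to the real axis, so that conjugation is
the reflection in the axis of the kite and yields its source. *)
Lemma kite_exists g theta tl tr : 0 < theta < pi ->
    valid_modulus g tl -> valid_modulus g tr ->
  exists k, is_kite g (radius_of g tl) (radius_of g tr) theta k.
Proof.
move=> th vl vr; have [l0 l1] := vl; have [r0 r1] := vr; have s0 := sin_gt0_pi th.
pose u : R[i] := tl%:C; pose v : R[i] := tr%:C * (cos theta +i* sin theta).
have nu : normc u = tl by rewrite /= expr0n/= addr0 sqrtr_sqr gtr0_norm.
have nv : normc v = tr.
  rewrite Normc.normcM /= cos2Dsin2 sqrtr1 mulr1 expr0n/= addr0 sqrtr_sqr.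
  by rewrite gtr0_norm.
have pu : plane g u by case: (g) l1; rewrite /plane /mkset ?nu.
have pv : plane g v by case: (g) r1; rewrite /plane /mkset ?nv.
have p0 : plane g (0 : R[i]) := plane0 g.
have ol0 : on_left g 0 u v.
  rewrite /on_left !seen_from0 /u /v; simpc => /=.
  by rewrite mulrA !mulr_gt0.
have olu : on_left g u v 0 by apply: on_left_cycle => //; apply: on_left_cycle.
have ang : angle g 0 u v = theta.
  rewrite /angle !seen_from0 nu nv /u /v; simpc => /=.
  rewrite mulrA [_ * cos _]mulrC mulfK ?mulf_neq0 ?lt0r_neq0//.
  by rewrite cosK// in_itv/=; move: th => /andP[/ltW-> /ltW->].
have b0 : seen_from g u v != 0.
  by apply: contraPneq olu => b0; rewrite /on_left b0 conjc0 mul0r ltxx.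
pose mu := conjc (seen_from g u v) / (normc (seen_from g u v))%:C.
have mu1 : normc mu = 1.
  rewrite Normc.normcM Normc.normcV normc_conjc /= expr0n/= addr0 sqrtr_sqr.
  by rewrite ger0_norm ?normc_ge0// divff// normc_eq0.
pose m x := mu * seen_from g u x.
have mr : rigid g m by apply: rigid_comp (rigid_rotation _ mu1) (rigid_seen_from pu).
have mu0 : m u = 0 by rewrite /m seen_from_self mulr0.
have mv : conjc (m v) = m v.
  rewrite /m /mu mulrAC [conjc _ * _]mulrC mul_conjc.
  by rewrite -fmorphV -rmorphM; exact: conjc_real.
pose s := conjc (m 0).
have pm x : plane g x -> plane g (m x) by exact: (rigid_plane mr).
exists (Kite (m u) (m v) s (m 0)).
have d1 : dist g (m u) (m 0) = radius_of g tl.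
  by rewrite rigid_dist// dist_sym distE seen_from0 nu.
have d2 : dist g (m v) (m 0) = radius_of g tr.
  by rewrite rigid_dist// dist_sym distE seen_from0 nv.
have mu' : conjc (m u) = m u by rewrite mu0 conjc0.
have ol : on_left g (m u) (m v) (m 0) by apply/rigid_on_left.
have an : angle g (m 0) (m u) (m v) = theta by rewrite rigid_angle.
have ds x : conjc x = x -> dist g x s = dist g x (m 0) by move=> {1}<-; exact: dist_conjc.
split => /=; rewrite ?ds//.
- by split; rewrite /s; do ?apply: plane_conjc; apply: pm.
- by split=> //; rewrite -{1}mu' -mv angle_conjc.
- by split=> //; rewrite -mu' -mv; apply/on_left_conjc.
Qed.

(** The hyperbolic plane has no similarities besides isometries. *)
Definition compatible_scale g (lambda : R) :=
  0 < lambda /\ match g with Euclidean => True | Hyperbolic => lambda = 1 end.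

Record scaling g (lambda : R) (h h' : R[i] -> R[i]) : Prop := Scaling {
  scaling_plane : forall x, plane g x -> plane g (h x);
  scaling_planeV : forall x, plane g x -> plane g (h' x);
  scalingK : forall x, plane g x -> h' (h x) = x;
  scalingVK : forall x, plane g x -> h (h' x) = x;
  scaling_dist : forall x y, plane g x -> plane g y ->
    dist g (h x) (h y) = lambda * dist g x y }.

Lemma mul_scaling g lambda mu : compatible_scale g lambda -> normc mu = lambda ->
  scaling g lambda ( *%R mu) ( *%R mu^-1).
Proof.
move=> [la0 la1] mul.
have mu0 : mu != 0 by rewrite -normc_gt0 mul.
split.
- by move=> x; case: g la1 => //= la1 px; rewrite Normc.normcM mul la1 mul1r.
- by move=> x; case: g la1 => //= la1 px; rewrite Normc.normcM Normc.normcV mul la1 invr1 mul1r.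
- by move=> x _; rewrite mulKf.
- by move=> x _; rewrite mulVKf.
move=> x y px py; case: g la1 px py => la1 px py.
  by rewrite /= -mulrBr Normc.normcM mul.
by rewrite la1 mul1r; apply: rigid_dist => //; apply: rigid_rotation; rewrite mul.
Qed.

Lemma kite_invariantZ g theta lambda rl rr :
    compatible_scale g lambda -> 0 < rl -> 0 < rr ->
  kite_invariant g theta (modulus g (lambda * rl)) (modulus g (lambda * rr)) =
  (lambda ^+ 2)%:C * kite_invariant g theta (modulus g rl) (modulus g rr).
Proof.
move=> [la0 la1] l0 r0; case: g la1 => /= la1; last by rewrite la1 !mul1r expr1n mul1r.
rewrite /kite_invariant /=; simpc; congr (_ +i* _); last by ring.
by field; rewrite !lt0r_neq0.
Qed.

Lemma modulusZ g lambda (r : R) : compatible_scale g lambda ->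
  modulus g (lambda * r) = lambda * modulus g r.
Proof. by move=> [_]; case: g => //= ->; rewrite !mul1r. Qed.

(** Seen from the left centers, multiplication by mu = b' / b takes one kite
to the other: it takes the right center b to b', and then, by
[kite_invariantZ], the target to the target and the source to the source. *)
Lemma kite_similar g lambda theta rl rr k k' :
    compatible_scale g lambda -> 0 < theta < pi -> 0 < rl -> 0 < rr ->
    is_kite g rl rr theta k -> is_kite g (lambda * rl) (lambda * rr) theta k' ->
  exists h h', scaling g lambda h h' /\
    k' = Kite (h (lcenter k)) (h (rcenter k)) (h (source k)) (h (target k)).
Proof.
move=> la th l0 r0 kk kk'; have [la0 _] := la.
have [l0' r0'] : 0 < lambda * rl /\ 0 < lambda * rr by rewrite !mulr_gt0.
have tK := kite_target_product th l0 r0 kk.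
have sK := kite_source_product th l0 r0 kk.
have tK' := kite_target_product th l0' r0' kk'.
have sK' := kite_source_product th l0' r0' kk'.
rewrite kite_invariantZ// in tK' sK'.
case: kk kk' => -[pl pr ps pt] [ls lt] _ _ [ol _].
case=> -[pl' pr' ps' pt'] [ls' lt'] _ _ [ol' _].
have at_ := dist_modulus pl pt lt; have at' := dist_modulus pl' pt' lt'.
set Z := kite_invariant _ _ _ _ in tK sK tK' sK'.
set b := seen_from g _ (rcenter k) in tK sK.
set b' := seen_from g _ (rcenter k') in tK' sK'.
have b0 : b != 0.
  by apply: contraPneq ol => b0; rewrite /on_left -/b b0 conjc0 mul0r ltxx.
have b0' : b' != 0.
  by apply: contraPneq ol' => b0'; rewrite /on_left -/b' b0' conjc0 mul0r ltxx.
pose mu := b' / b.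
have [t0 _] := modulus_valid g l0.
have nb : normc b' = lambda * normc b.
  have := congr1 normc tK'; rewrite -tK !Normc.normcM !normc_conjc at_ at' modulusZ//.
  rewrite /= expr0n/= addr0 sqrtr_sqr ger0_norm ?sqr_ge0// => E.
  apply: (@mulfI _ (lambda * modulus g rl)); first by rewrite lt0r_neq0// mulr_gt0.
  by rewrite E; ring.
have nmu : normc mu = lambda.
  by rewrite Normc.normcM Normc.normcV nb mulfK// normc_eq0.
have [mp mpV mK mVK md] := mul_scaling la nmu.
have muM : mu * conjc mu = (lambda ^+ 2)%:C by rewrite mul_conjc nmu.
have muB : mu * b = b' by rewrite divfK.
have cb0 : conjc b' != 0 by rewrite conjc_eq0.
pose h x := seen_from g (- lcenter k') (mu * seen_from g (lcenter k) x).
pose h' x := seen_from g (- lcenter k) (mu^-1 * seen_from g (lcenter k') x).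
have plN := planeN pl; have plN' := planeN pl'.
have sub x : plane g x -> plane g (seen_from g (lcenter k) x) by exact: plane_seen_from.
have sub' x : plane g x -> plane g (seen_from g (lcenter k') x) by exact: plane_seen_from.
have back x : plane g x -> seen_from g (lcenter k) (seen_from g (- lcenter k) x) = x.
  by move=> px; rewrite -{1}[lcenter k]opprK seen_fromK.
have back' x : plane g x -> seen_from g (lcenter k') (seen_from g (- lcenter k') x) = x.
  by move=> px; rewrite -{1}[lcenter k']opprK seen_fromK.
exists h, h'; split.
  split.
  - by move=> x px; apply: plane_seen_from => //; apply/mp/sub.
  - by move=> x px; apply: plane_seen_from => //; apply/mpV/sub'.
  - by move=> x px; rewrite /h /h' back' ?mK ?seen_fromK//; do ?[apply: mp]; apply: sub.
  - by move=> x px; rewrite /h /h' back ?mVK ?seen_fromK//; do ?[apply: mpV]; apply: sub'.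
  - move=> x y px py; rewrite /h (rigid_dist (rigid_seen_from plN')) ?md//; try exact: sub.
    + by rewrite (rigid_dist (rigid_seen_from pl)).
    + exact/mp/sub.
    + exact/mp/sub.
have hE x y : plane g y -> seen_from g (lcenter k') y = mu * seen_from g (lcenter k) x -> h x = y.
  by move=> py E; rewrite /h -E seen_fromK.
rewrite (hE (lcenter k) (lcenter k'))// ?seen_from_self ?mulr0//.
rewrite (hE (rcenter k) (rcenter k'))//.
rewrite (hE (source k) (source k'))//; last first.
  apply: (mulIf cb0); rewrite sK' -muB [conjc (mu * b)]conjM mulrACA muM sK.
  by rewrite conjM conjc_real.
rewrite (hE (target k) (target k'))//; last first.
  by apply: (mulIf cb0); rewrite tK' -muB [conjc (mu * b)]conjM mulrACA muM tK.
by case: (k').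
Qed.

End Kites.

(** * Circle patterns and their similarities *)

Section Patterns.
Context {R : realType} {g : geometry} {S : cellular_surface}.
Context {thetas : edge S -> R}.
Hypothesis thetas_itv : forall x : edge S, 0 < thetas x < pi.
Implicit Types (P Q : circle_pattern g thetas) (e : oedge S) (f : face S).
Implicit Types (p q : oedge S * R[i]).

Definition log_modulus P f := ln (modulus g (radius P f)).

Lemma cone_angleE P f : cone_angle P f = total_angle thetas g (log_modulus P) f.
Proof.
rewrite /cone_angle /total_angle; congr (2 * _); apply: eq_bigr => e _.
apply: kite_half_angle (pkiteP P e); rewrite ?radius_gt0//.
exact: ext_itv.
Qed.

Lemma log_modulus_dom P f : log_dom g (log_modulus P f).
Proof.
rewrite /log_modulus; move: (modulus g _) (modulus_valid g (radius_gt0 P f)) => m.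
by case: g => // -[m0 m1]; rewrite /= ln_lt0// m0.
Qed.

Lemma radius_log_modulus P f : radius P f = radius_of g (expR (log_modulus P f)).
Proof.
have r0 := radius_gt0 P f; rewrite lnK ?modulusK//.
by case: (modulus_valid g r0).
Qed.

(** Each unoriented edge needs a single kite, so it is constructed for one
chosen orientation [rep] and turned around for the other one. *)
Lemma pattern_exists (rho : face S -> R) : (forall f, log_dom g (rho f)) ->
  exists P : circle_pattern g thetas, log_modulus P = rho.
Proof.
move=> dom.
have vm f : valid_modulus g (expR (rho f)).
  by split; [exact: expR_gt0|case: (g) (dom f) => //= d; rewrite expR_lt1].
pose K e := projT1 (cid (kite_exists (ext_itv thetas_itv e)
  (vm (left_face e)) (vm (right_face e)))).
have KP e : is_kite g (radius_of g (expR (rho (left_face e))))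
    (radius_of g (expR (rho (right_face e)))) (pi - thetas (edge_of e)) (K e).
  by rewrite /K; case: cid.
pose rep (x : edge S) := projT1 (cid (edge_of_surj x)).
have repP x : edge_of (rep x) = x by rewrite /rep; case: cid.
pose k e := if rep (edge_of e) == e then K e else kite_opp (K (opp e)).
have k_opp e : k (opp e) = kite_opp (k e).
  rewrite /k edge_of_opp oppK.
  have /edge_ofP[ee|ee] : edge_of e = edge_of (rep (edge_of e)) by rewrite repP.
    by rewrite ee eqxx eq_sym (negbTE (opp_neq e)).
  by rewrite ee eqxx (negbTE (opp_neq e)) kite_oppK.
have kP e : is_kite g (radius_of g (expR (rho (left_face e))))
    (radius_of g (expR (rho (right_face e)))) (pi - thetas (edge_of e)) (k e).
  rewrite /k; case: ifP => _; first exact: KP.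
  by apply: is_kite_opp; have := KP (opp e); rewrite edge_of_opp right_opp.
have r0 f : 0 < radius_of g (expR (rho f)) by exact: radius_of_gt0.
exists (CirclePattern r0 k_opp kP); apply/funext => f.
rewrite /log_modulus /= radius_ofK ?expRK// ?expR_ge0//.
by case: (vm f).
Qed.

(** Kite by kite maps that commute with the reversal of edges. Inverse maps
have the same form, which gives both directions of the claims about the glued
surfaces from one. *)
Record kite_map (lambda : R) P Q (h : oedge S -> R[i] -> R[i]) : Prop := KiteMap {
  kite_map_opp : forall e, h (opp e) =1 h e;
  kite_map_plane : forall e x, plane g x -> plane g (h e x);
  kite_map_dist : forall e x y, plane g x -> plane g y ->
    dist g (h e x) (h e y) = lambda * dist g x y;
  kite_map_kite : forall e, pkite Q e = let k := pkite P e in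
    Kite (h e (lcenter k)) (h e (rcenter k)) (h e (source k)) (h e (target k)) }.

Section KiteMap.
Variables (lambda : R) (P Q : circle_pattern g thetas) (h : oedge S -> R[i] -> R[i]).
Hypothesis hm : kite_map lambda P Q h.

Lemma kite_map_segment e a b x : plane g a -> plane g b ->
  segment g a b x -> segment g (h e a) (h e b) (h e x).
Proof.
case: hm => _ hp hd _ pa pb [px E]; split; first exact: hp.
by rewrite !hd// -mulrDr E.
Qed.

Lemma kite_map_triangle e a b c x : plane g a -> plane g b -> plane g c ->
  triangle g a b c x -> triangle g (h e a) (h e b) (h e c) (h e x).
Proof.
move=> pa pb pc [y ybc xay]; exists (h e y); first exact: kite_map_segment.
by apply: kite_map_segment => //; case: ybc.
Qed.

Lemma kite_map_region e x : kite_region g (pkite P e) x ->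
  kite_region g (pkite Q e) (h e x).
Proof.
have [[pl pr ps pt] _ _ _ _] := pkiteP P e.
by rewrite (kite_map_kite hm) => -[|] H; [left|right]; exact: kite_map_triangle.
Qed.

Lemma kite_map_glue p q : glue P p q -> glue Q (p.1, h p.1 p.2) (q.1, h q.1 q.2).
Proof.
case: p q => e x [e' x'] /=; case=> [[/= xs ee xx]|[/= nx sx sx' dx]].
  left; split => //=; first exact: kite_map_region.
  by rewrite ee xx (kite_map_opp hm).
have [[pl _ _ pt] _ _ _ _] := pkiteP P e.
have [[pl' _ ps' _] _ _ _ _] := pkiteP P e'.
right; split; rewrite //= !(kite_map_kite hm) /=.
- exact: kite_map_segment.
- exact: kite_map_segment.
- by rewrite !(kite_map_dist hm) ?dx//; [case: sx'|case: sx].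
Qed.

Lemma kite_map_same_point p q : same_point P p q ->
  same_point Q (p.1, h p.1 p.2) (q.1, h q.1 q.2).
Proof.
elim=> {p q} [p q /kite_map_glue|p|p q _ IH|p q r _ IH1 _ IH2].
- exact: Relation_Operators.rst_step.
- exact: Relation_Operators.rst_refl.
- exact: Relation_Operators.rst_sym.
- exact: Relation_Operators.rst_trans IH1 IH2.
Qed.

End KiteMap.

Lemma kite_region_plane (k : kite R) x : kite_region g k x -> plane g x.
Proof. by case=> -[y _ []]. Qed.

Lemma similarity_exists (lambda : R) P Q : compatible_scale g lambda ->
    (forall f, radius Q f = lambda * radius P f) ->
  exists h, is_similarity lambda P Q h.
Proof.
move=> la rad; have [la0 _] := la.
pose good x (hh : (R[i] -> R[i]) * (R[i] -> R[i])) := scaling g lambda hh.1 hh.2 /\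
  forall e, edge_of e = x -> pkite Q e = let k := pkite P e in
    Kite (hh.1 (lcenter k)) (hh.1 (rcenter k)) (hh.1 (source k)) (hh.1 (target k)).
have /choice[H HP] : forall x, exists hh, good x hh.
  move=> x; have [e <-] := edge_of_surj x.
  have kQ := pkiteP Q e; rewrite !rad in kQ.
  have [h [h' [hs hk]]] := kite_similar la (ext_itv thetas_itv e)
    (radius_gt0 P (left_face e)) (radius_gt0 P (right_face e)) (pkiteP P e) kQ.
  exists (h, h'); split=> //= e' /esym/edge_ofP[->//|->].
  by rewrite !pkite_opp hk.
pose h e := (H (edge_of e)).1; pose h' e := (H (edge_of e)).2.
have hs e : scaling g lambda (h e) (h' e) by case: (HP (edge_of e)).
have hk e : pkite Q e = let k := pkite P e in
    Kite (h e (lcenter k)) (h e (rcenter k)) (h e (source k)) (h e (target k)).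
  by case: (HP (edge_of e)) => _; exact.
have mP : kite_map lambda P Q h.
  split=> //.
  - by move=> e x; rewrite /h edge_of_opp.
  - by move=> e; exact: scaling_plane (hs e).
  - by move=> e; exact: scaling_dist (hs e).
have mQ : kite_map lambda^-1 Q P h'.
  split.
  - by move=> e x; rewrite /h' edge_of_opp.
  - by move=> e; exact: scaling_planeV (hs e).
  - move=> e x y px py.
    rewrite -[in RHS](scalingVK (hs e) px) -[in RHS](scalingVK (hs e) py).
    rewrite (scaling_dist (hs e)) ?mulKf ?lt0r_neq0//; exact: scaling_planeV (hs e) _ _.
  - move=> e; rewrite hk /=; have [[pl pr ps pt] _ _ _ _] := pkiteP P e.
    by rewrite !(scalingK (hs e))//; case: (pkite P e).
exists h; split=> //.
- move=> e; split.
  + by move=> x; apply: (kite_map_region mP).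
  + move=> x y; rewrite !inE => /kite_region_plane px /kite_region_plane py E.
    by rewrite -(scalingK (hs e) px) E (scalingK (hs e) py).
  + move=> y yQ; exists (h' e y); first exact: (kite_map_region mQ).
    by rewrite (scalingVK (hs e))//; exact: kite_region_plane yQ.
- move=> e x y /kite_region_plane px /kite_region_plane py.
  exact: scaling_dist (hs e) _ _ px py.
move=> [e x] [e' x'] /kite_region_plane/= px /kite_region_plane/= px'.
split; first exact: (kite_map_same_point mP).
move=> /(kite_map_same_point mQ)/=.
by rewrite (scalingK (hs e))// (scalingK (hs e')).
Qed.

End Patterns.

Theorem theorem3 (R : realType) (S : cellular_surface)
  (thetas : edge S -> R) (Phi : face S -> R)
  (thetas_itv : forall x : edge S, 0 < thetas x < pi)
  (Phi_gt0 : forall f : face S, 0 < Phi f) :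
  (* Euclidean case *)
  (((exists P : circle_pattern Euclidean thetas, has_cone_angles P Phi) <->
    (\sum_(f : face S) Phi f = \sum_(x : edge S) 2 * thetas x /\
     forall F' : {set face S}, F' != finset.set0 -> F' != [set: face S]%SET ->
       \sum_(f in F') Phi f < \sum_(x in incident_edges F') 2 * thetas x)) /\
   (forall P Q : circle_pattern Euclidean thetas,
      has_cone_angles P Phi -> has_cone_angles Q Phi -> similar_patterns P Q)) /\
  (* hyperbolic case *)
  (((exists P : circle_pattern Hyperbolic thetas, has_cone_angles P Phi) <->
    (forall F' : {set face S}, F' != finset.set0 ->
       \sum_(f in F') Phi f < \sum_(x in incident_edges F') 2 * thetas x)) /\
   (forall P Q : circle_pattern Hyperbolic thetas,
      has_cone_angles P Phi -> has_cone_angles Q Phi -> isometric_patterns P Q)).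
Proof.
have totalE g (P : circle_pattern g thetas) : has_cone_angles P Phi ->
    forall f, total_angle thetas g (log_modulus P) f = Phi f.
  by move=> PPhi f; rewrite -PPhi cone_angleE.
have exE g (rho : face S -> R) : (forall f, log_dom g (rho f)) ->
    (forall f, total_angle thetas g rho f = Phi f) ->
    exists P : circle_pattern g thetas, has_cone_angles P Phi.
  move=> dom rhoPhi; have [P Prho] := pattern_exists thetas_itv dom.
  by exists P => f; rewrite cone_angleE// Prho.
have necessary g (P : circle_pattern g thetas) (F' : {set face S}) :
    has_cone_angles P Phi -> F' != finset.set0 ->
    (g = Euclidean -> F' != [set: face S]%SET) ->
    \sum_(f in F') Phi f < \sum_(x in incident_edges F') 2 * thetas x.
  move=> /totalE PPhi F0 FT.
  rewrite -(eq_bigr _ (fun f _ => PPhi f)).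
  by apply: sum_total_angle_lt => // f; rewrite PPhi.
split; split.
- split=> [[P PPhi]|[sumT cond]].
    split; last by move=> F' F0 FT; exact: necessary PPhi F0 _.
    rewrite -(sum_total_angle_euc thetas_itv (log_modulus P)).
    by apply: eq_bigr => f _; rewrite totalE.
  have [rho rhoPhi] := exists_euclidean_radii thetas_itv sumT cond.
  exact: exE rhoPhi.
- move=> P Q /totalE PPhi /totalE QPhi.
  have [|d dP] := @euclidean_radii_unique _ _ _ thetas_itv
    (log_modulus P) (log_modulus Q).
    by move=> f; rewrite PPhi QPhi.
  exists (expR d); first exact: expR_gt0.
  apply: similarity_exists => // [|f]; first by split=> //; exact: expR_gt0.
  by rewrite !radius_log_modulus dP /= expRD mulrC.
- split=> [[P PPhi] F' F0|cond]; first exact: necessary PPhi F0 _.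
  have [rho rho0 rhoPhi] := exists_hyperbolic_radii thetas_itv Phi_gt0 cond.
  exact: (exE Hyperbolic rho).
- move=> P Q /totalE PPhi /totalE QPhi.
  have E f : log_modulus Q f = log_modulus P f.
    have nP : forall h, log_modulus P h < 0 by exact: (log_modulus_dom P).
    have nQ : forall h, log_modulus Q h < 0 by exact: (log_modulus_dom Q).
    by apply/le_anti/andP; split; apply: (hyperbolic_radii_le thetas_itv);
      move=> // h; rewrite ?PPhi ?QPhi.
  apply: similarity_exists => // f.
  by rewrite mul1r !radius_log_modulus E.
Qed.
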